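(* There exists an absolute constant $c>0$ such that the following holds for all positive integers $n,m$. Let $F$ be a finite field with at least $(c\log(nm))^m$ elements. Then there is no winning linear guessing strategy for the hat guessing game on $K_n^{(m)}$ over $F$.
   Context: $K_n^{(m)}$ denotes the complete $m$-partite graph with $n$ vertices in each of its $m$ parts (two vertices are adjacent iff they lie in different parts). In the hat guessing game on a graph over a finite field $F$, each vertex is assigned a hat color which is an arbitrary element of $F$; each vertex sees exactly the colors of its neighbors, and all vertices simultaneously guess their own colors according to a strategy fixed in advance, without communication. A linear guessing strategy over $F$ is one in which the guess of each vertex $w$ is an affine function over $F$ of the colors of its neighbors, i.e. of the form $\sum_{w'\sim w} a_{w,w'}x_{w'}+b_w$ with $a_{w,w'},b_w\in F$, where $x_{w'}$ is the color of $w'$. A strategy is winning if for every assignment of colors to all vertices at least one vertex guesses its own color correctly. *)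

(* Defs.v *)
From mathcomp Require Import all_boot all_algebra.
Set Implicit Arguments. Unset Strict Implicit. Unset Printing Implicit Defensive.
Import GRing.Theory.
Local Open Scope ring_scope.

Definition linear_guess (F : fieldType) (V : finType) (e : rel V)
  (a : V -> V -> F) (b : V -> F) (x : V -> F) (w : V) : F :=
  \sum_(w' | e w w') a w w' * x w' + b w.

Definition winning_linear (F : fieldType) (V : finType) (e : rel V)
  (a : V -> V -> F) (b : V -> F) : Prop :=
  forall x : V -> F, exists w : V, linear_guess e a b x w = x w.

(* Complete m-partite graph K_n^(m): vertices (part i < m, index j < n);
   adjacent iff they lie in different parts. *)
Definition Kmpart_adj (m n : nat) : rel ('I_m * 'I_n) :=
  fun v w => v.1 != w.1.

Definition has_winning_linear_strategy (F : fieldType) (V : finType) (e : rel V) : Prop :=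
  exists (a : V -> V -> F) (b : V -> F), winning_linear e a b.
Arguments Kmpart_adj : clear implicits.

(* Main.v *)
Require Import Defs.
From mathcomp Require Import all_boot all_order all_algebra all_field.
From mathcomp Require Import zify ring lra.
Set Implicit Arguments. Unset Strict Implicit. Unset Printing Implicit Defensive.
Import Order.TTheory GRing.Theory Num.Theory.
Local Open Scope ring_scope.

(** A winning strategy says that the hyperplanes [x w - sum a x = b w] cover the space
    of colourings.  Suppose first that [F = F_p], and take an irredundant subcover by [k]
    hyperplanes with normals [f_i] of rank [r].  The key estimate is
    [(p - 1)^r <= (C log k)^k]; since the normals of one part are independent,
    [k <= m * r], and this bounds [p] by about [(C log (n m))^m].

    For every choice of nonzero scalars [t], expanding a product of factors
    [1 - chi (t_j (f_j - b_j))] into characters shows that each [i] occurs in a relation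
    [sum_j eps_j t_j f_j = 0] with coefficients in [{-1, 0, 1}].  Sums of the relations in
    random sets of rows, of geometrically increasing density, give [O(log k)] relations
    such that every [j] has a nonzero coefficient in one of them and the first such
    coefficients have [O(k)] bits in total.  Recording for each [j] the index of that
    relation and the coefficient takes [(C log k)^k] values, and each record is
    compatible with at most [(p - 1)^(k - r)] of the [(p - 1)^k] scalars [t].

    If [#|F| = p^e], each coordinate is composed with a suitable [F_p]-linear functional
    [F -> F_p].  Starting from Frobenius powers, which make any [e] parts independent,
    and exchanging one functional at a time, one arranges that the parts fall into
    [b] chunks, each part lying in [q < p] of them with [b] about [q m / e], so that
    every chunk is [F_p]-independent; hence [q * k <= b * r] and the estimate for
    [F_p] applies.  When [e >= m] all parts fit in a single chunk. *)

(** * Random sums of sparse relations *)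

(** Bernoulli's inequality. It means that if [d >= n] rows are each active with probability [1 / n],
    then none is active with probability at most [1 / 2]. *)
Lemma double_expn_pred (n d : nat) : (0 < n <= d)%N -> (n.-1 ^ d * 2 <= n ^ d)%N.
Proof.
case: n => [|y] // /andP[_ hd] /=.
case: (posnP y) hd => [-> hd|y0 hd]; first by rewrite exp0n.
have bern (i : nat) : (y ^ i * (y + i) <= y * y.+1 ^ i)%N.
  elim: i => [|i IH]; first by rewrite !expn0 mul1n muln1 addn0.
  rewrite !expnS; move: IH; move: (y ^ i)%N (y.+1 ^ i)%N => u v IH; nia.
rewrite -(leq_pmul2l y0); apply: leq_trans (bern d).
by rewrite mulnA (mulnC y) -mulnA leq_mul2l mulnC; apply/orP; right; lia.
Qed.

(** An affine majorant of the logarithm, so that its mean is controlled by the mean of [m]. *)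
Lemma trunc_log2_le_affine (R : realFieldType) (g m : nat) : (trunc_log 2 m)%:R <= g%:R + m%:R / 2 ^+ g :> R.
Proof.
have p2 : 0 < 2 ^+ g :> R by rewrite exprn_gt0.
case: (leqP (trunc_log 2 m) g) => [le_g|lt_g].
  by rewrite -[leLHS]addr0 lerD ?ler_nat // divr_ge0 // ltW.
have m0 : (0 < m)%N by case: m lt_g => [|//]; rewrite trunc_log0.
have /andP[hm _] := trunc_log_bounds (isT : (1 < 2)%N) m0.
rewrite -{1}(subnKC (ltnW lt_g)) natrD lerD2l ler_pdivlMr // -natrX -natrM ler_nat.
apply: leq_trans hm; rewrite -{2}(subnK (ltnW lt_g)) expnD leq_mul2r.
by rewrite (ltnW (ltn_expl _ _)) // orbT.
Qed.

Lemma card_ffun_forall (T J : finType) (P : T -> pred J) :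
  #|[set a : {ffun T -> J} | [forall i, P i (a i)]]| = (\prod_i #|[set j | P i j]|)%N.
Proof.
under [RHS]eq_bigr => i _ do rewrite -sum1_card big_mkcond /=.
rewrite bigA_distr_bigA /= -sum1_card big_mkcond; apply: eq_bigr => a _.
rewrite inE; case: forallP => [aP|/forallP]; first by rewrite big1 // => i _; rewrite inE aP.
by rewrite negb_forall => /existsP[i /negPf aPi]; rewrite (bigD1 i) //= inE aPi.
Qed.

Lemma card_ffun_at (T J : finType) (i : T) (P : pred J) :
  (#|[set a : {ffun T -> J} | P (a i)]| * #|J| = #|[set j | P j]| * #|J| ^ #|T|)%N.
Proof.
have -> : [set a : {ffun T -> J} | P (a i)]
    = [set a : {ffun T -> J} | [forall k, (k == i) ==> P (a k)]].
  apply/setP => a; rewrite !inE; apply/idP/forallP => [Pa k|/(_ i)]; last by rewrite eqxx.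
  by apply/implyP => /eqP ->.
rewrite (card_ffun_forall (fun k => [pred j | (k == i) ==> P j])) (bigD1 i) //= eqxx /= -mulnA; congr (_ * _)%N.
rewrite (eq_bigr (fun=> #|J|)); last first.
  by move=> k /negPf -> /=; rewrite -cardsT; apply: eq_card => j; rewrite !inE.
rewrite prod_nat_const -expnSr (@eq_card _ _ (predC1 i)) // cardC1 prednK //.
by apply/card_gt0P; exists i.
Qed.

Lemma card_ffun_off (T J : finType) (D : {set T}) (P : pred J) :
  (#|[set a : {ffun T -> J} | [forall i in D, P (a i)]]| = #|[set j | P j]| ^ #|D| * #|J| ^ #|~: D|)%N.
Proof.
rewrite (card_ffun_forall (fun k => [pred j | (k \in D) ==> P j])) (bigID (mem D)) /=; congr (_ * _)%N.
  rewrite (eq_bigr (fun=> #|[set j | P j]|)) ?prod_nat_const // => i iD.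
  by apply: eq_card => j; rewrite !inE iD.
rewrite (eq_bigr (fun=> #|J|)); last first.
  by move=> i /negPf iD; rewrite -cardsT; apply: eq_card => j; rewrite !inE iD.
by rewrite prod_nat_const; congr (_ ^ _)%N; apply: eq_card => i; rewrite !inE.
Qed.

Section RandomRows.
Variables (R : realFieldType) (T : finType) (E : fieldType) (eps : T -> T -> int).
Hypothesis eps_small : forall i j, (`|eps i j| <= 1)%N.

Definition rel_coef (x : {set T}) (j : T) : int := \sum_(i in x) eps i j.
Definition hit_count (x : {set T}) (j : T) : nat := #|[set i in x | eps i j != 0]|.
Definition degree (j : T) : nat := #|[set i | eps i j != 0]|.
(** Tested in [E] because a nonzero integer coefficient may vanish modulo the characteristic. *)
Definition covers (x : {set T}) (j : T) : bool := (rel_coef x j)%:~R != 0 :> E.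

Lemma eps_unit i j : eps i j != 0 -> (eps i j)%:~R != 0 :> E.
Proof.
move: (eps_small i j); case: (eps i j) => [[|[|n]]|[|n]] //= _ _.
  exact: oner_neq0.
by rewrite mulrN1z oppr_eq0 oner_neq0.
Qed.

Lemma rel_coef_le x j : (`|rel_coef x j| <= hit_count x j)%N.
Proof.
rewrite /rel_coef /hit_count (bigID [pred i | eps i j != 0]) /=.
rewrite [X in _ + X]big1 ?addr0; last by move=> i /andP[_ /negPn /eqP].
rewrite -sum1_card -(ler_nat int) natr_sum natz abszE.
apply: le_trans (ler_norm_sum _ _ _) _.
under [X in _ <= X]eq_bigl => i do rewrite inE.
by apply: ler_sum => i _; have := eps_small i j; lia.
Qed.

(** Each row gets an [n]-sided die, active at [0], and a fair coin, so it is kept with probability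
    [1 / (2 * n)]. The coin is separate so that it can be toggled with the dice fixed. *)
Definition draw (n : nat) : finType := ({ffun T -> 'I_n} * {ffun T -> bool})%type.
Definition drawn (n : nat) (w : draw n) : {set T} :=
  [set i | (w.1 i == 0 :> nat) && w.2 i].

Lemma card_draw n : #|draw n| = (n ^ #|T| * 2 ^ #|T|)%N.
Proof. by rewrite card_prod !card_ffun card_ord card_bool. Qed.

Lemma card_drawn_row n i : (0 < n)%N -> (#|[set w : draw n | i \in drawn w]| * (2 * n) = #|draw n|)%N.
Proof.
move=> n0.
have -> : [set w : draw n | i \in drawn w]
        = setX [set a : {ffun T -> 'I_n} | a i == 0 :> nat] [set b : {ffun T -> bool} | b i].
  by apply/setP => -[a b]; rewrite !inE.
have := card_ffun_at i (fun k : 'I_n => k == 0 :> nat).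
have := card_ffun_at i (fun b : bool => b).
rewrite cardsX card_draw card_bool card_ord.
have -> : #|[set b : bool | b]| = 1%N by rewrite -(cards1 true); apply: eq_card => -[]; rewrite !inE.
have -> : #|[set k : 'I_n | k == 0 :> nat]| = 1%N.
  by rewrite -(cards1 (Ordinal n0)); apply: eq_card => k; rewrite !inE.
by move=> hb ha; rewrite (mulnC 2) mulnACA ha hb !mul1n.
Qed.

Lemma sum_hit_count n j : (0 < n)%N ->
  ((\sum_(w : draw n) hit_count (drawn w) j) * (2 * n) = degree j * #|draw n|)%N.
Proof.
move=> n0.
have -> : (\sum_(w : draw n) hit_count (drawn w) j
         = \sum_(i | eps i j != 0) #|[set w : draw n | i \in drawn w]|)%N.
  under eq_bigr => w _ do rewrite /hit_count -sum1_card.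
  under eq_bigr => w _ do (under eq_bigl => i do rewrite inE andbC).
  rewrite (exchange_big_dep (fun i => eps i j != 0)) /=; last by move=> w i _ /andP[].
  apply: eq_bigr => i ei; rewrite -sum1_card; apply: eq_bigl => w.
  by rewrite ei [RHS]inE.
rewrite big_distrl /= (eq_bigr (fun=> #|draw n|)) => [|i _]; last exact: card_drawn_row.
by rewrite sum_nat_const /degree; congr (_ * _)%N; apply: eq_card => i; rewrite inE.
Qed.

(* Once some row of the column is active, toggling the second coin of that row
   changes the coefficient by a unit, so at least half of the coins cover. *)
Lemma card_not_covers_active n (a : {ffun T -> 'I_n}) j i :
    eps i j != 0 -> a i == 0 :> nat ->
  (#|[set b : {ffun T -> bool} | ~~ covers (drawn (a, b)) j]| * 2 <= 2 ^ #|T|)%N.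
Proof.
move=> eij ai.
pose flip (b : {ffun T -> bool}) := [ffun k => (k == i) (+) b k].
have flipK : involutive flip.
  by move=> b; apply/ffunP => k; rewrite !ffunE addbA addbb.
set N := [set b | _].
have disj : [disjoint N & flip @: N].
  rewrite -setI_eq0; apply/eqP/setP => b; rewrite !inE; apply/negP => /andP[].
  rewrite /covers !negbK => /eqP zb /imsetP[b' + eb]; rewrite inE negbK => /eqP zb'.
  have rel_diff (c : {ffun T -> bool}) : ~~ c i ->
      rel_coef (drawn (a, flip c)) j = rel_coef (drawn (a, c)) j + eps i j.
    move=> ci; rewrite /rel_coef (bigD1 i) /=; last by rewrite inE /= ai ffunE eqxx /= ci.
    rewrite addrC; congr (_ + _); apply: eq_bigl => k; rewrite !inE /= ffunE.
    by case: (eqVneq k i) => [->|_] /=; rewrite ?(negPf ci) ?andbF ?andbT.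
  have [bi|bi] := boolP (b' i).
    have := rel_diff (flip b'); rewrite ffunE eqxx bi => /(_ isT); rewrite flipK -eb => e.
    by have := eps_unit eij; rewrite -[eps i j](addKr (rel_coef (drawn (a, b)) j)) -e rmorphD rmorphN /= zb zb' oppr0 addr0 eqxx.
  have := rel_diff b' bi; rewrite -eb => e.
  by have := eps_unit eij; rewrite -[eps i j](addKr (rel_coef (drawn (a, b')) j)) -e rmorphD rmorphN /= zb zb' oppr0 addr0 eqxx.
rewrite muln2 -addnn -{2}(card_imset N (inv_inj flipK)).
rewrite -cardsUI (eqP (_ : N :&: flip @: N == set0)) ?setI_eq0 // cards0 addn0.
by rewrite (leq_trans (max_card _)) // card_ffun card_bool.
Qed.

(** With probability at least [1 / 2] some row of the column is active, and then the coins fail at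
    most half of the time; failure thus has probability at most [3 / 4]. *)
Lemma card_not_covers n j : (0 < n <= degree j)%N ->
  (#|[set w : draw n | ~~ covers (drawn w) j]| * 4 <= 3 * #|draw n|)%N.
Proof.
move=> n0d; have [n0 _] := andP n0d.
pose D := [set i | eps i j != 0].
pose Q := [set a : {ffun T -> 'I_n} | [forall i in D, a i != 0 :> nat]].
have cardQ : (#|Q| * 2 <= n ^ #|T|)%N.
  rewrite /Q (card_ffun_off D [pred k : 'I_n | k != 0 :> nat]) card_ord -(cardsC D) expnD mulnAC leq_mul2r.
  apply/orP; right; apply: leq_trans (double_expn_pred n0d).
  rewrite leq_mul2r /=; have -> : #|[set k : 'I_n | k != 0 :> nat]| = n.-1.
    by rewrite -[in RHS](card_ord n) -(cardC1 (Ordinal n0)); apply: eq_card => k; rewrite !inE.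
  exact: leqnn.
have bound : (#|[set w : draw n | ~~ covers (drawn w) j]| * 2
              <= (n ^ #|T| + #|Q|) * 2 ^ #|T|)%N.
  have -> : #|[set w : draw n | ~~ covers (drawn w) j]|
     = (\sum_(a : {ffun T -> 'I_n}) #|[set b : {ffun T -> bool} | ~~ covers (drawn (a, b)) j]|)%N.
    rewrite -sum1_card big_mkcond /= (eq_bigr (fun w => ~~ covers (drawn (w.1, w.2)) j : nat)).
      rewrite -(pair_big xpredT xpredT (fun a b => ~~ covers (drawn (a, b)) j : nat)) /=.
      apply: eq_bigr => a _; rewrite -sum1_card [RHS]big_mkcond /=; apply: eq_bigr => b _.
      by rewrite inE; case: ifP.
    by case=> a b _; rewrite inE /=; case: ifP.
  rewrite big_distrl /=.
  apply: (@leq_trans (\sum_(a : {ffun T -> 'I_n}) (1 + (a \in Q)) * 2 ^ #|T|)%N).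
    apply: leq_sum => a _; have [aQ|aQ] := boolP (a \in Q).
      by rewrite mulnC leq_mul2l /= (leq_trans (max_card _)) // card_ffun card_bool.
    move: aQ; rewrite inE negb_forall => /existsP[i]; rewrite negb_imply inE => /andP[ei /negPn ai].
    by rewrite mul1n; apply: card_not_covers_active ei ai.
  rewrite -big_distrl leq_mul2r big_split /= sum_nat_const card_ffun card_ord muln1.
  by rewrite leq_add2l -[#|Q|]sum1_card [X in (_ <= X)%N]big_mkcond leq_sum ?orbT // => a _; case: ifP.
rewrite card_draw; move: bound cardQ; move: (n ^ _)%N (2 ^ _)%N #|Q| #|_| => u v r s; nia.
Qed.

Fixpoint cover_cost (V : R) (xs : seq {set T}) (j : T) : R :=
  if xs is x :: xs' then
    if covers x j then (trunc_log 2 (hit_count x j))%:R else cover_cost V xs' j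
  else V.

(* An upper bound for the expected [cover_cost] of a column of degree about [2 ^ l]
   when the successive draws keep each row with probability [2 ^ (- s - 1)]. *)
Fixpoint potential (V : R) (ss : seq nat) (l : nat) : R :=
  if ss is s :: ss' then
    if (s <= l)%N then (l - s)%:R + 1 + 3 / 4 * potential V ss' l
    else 2 ^+ l / 2 ^+ s + potential V ss' l
  else V.

Lemma potential_ge0 V ss l : 0 <= V -> 0 <= potential V ss l.
Proof.
move=> V0; elim: ss => [|s ss IH] //=; case: ifP => _.
  apply: addr_ge0; first by rewrite addr_ge0 ?ler0n ?ler01.
  by apply: mulr_ge0 => //; rewrite divr_ge0 ?ler0n.
by rewrite addr_ge0 // divr_ge0 // exprn_ge0.
Qed.

Lemma cover_cost_ge0 V xs j : 0 <= V -> 0 <= cover_cost V xs j.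
Proof. by move=> V0; elim: xs => [|x xs IH] //=; case: ifP. Qed.

(** The mean of [hit_count] is at most [2 ^ l / 2 ^ s]. For [s <= l] the affine bound with
    [g = l - s] gives mean cost at most [l - s + 1], and failure has probability at most [3 / 4].
    For [s > l] the bound is used with [g = 0], and failure is only bounded by [1]. *)
Lemma mean_cover_cost s ss V j l : (2 ^ l <= degree j < 2 ^ l.+1)%N -> 0 <= V ->
  \sum_(w : draw (2 ^ s)) (if covers (drawn w) j then (trunc_log 2 (hit_count (drawn w) j))%:R
                           else potential V ss l)
  <= #|draw (2 ^ s)|%:R * potential V (s :: ss) l.
Proof.
move=> /andP[le_l lt_l] V0 /=; set W := potential V ss l; set Om := #|_|.
have W0 : 0 <= W by exact: potential_ge0.
have n0 : (0 < 2 ^ s)%N by rewrite expn_gt0.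
have p2 k : 0 < 2 ^+ k :> R by rewrite exprn_gt0.
have mean_hits : \sum_(w : draw (2 ^ s)) (hit_count (drawn w) j)%:R <= Om%:R * (2 ^+ l / 2 ^+ s) :> R.
  rewrite mulrA ler_pdivlMr // -natr_sum -natrX -natrX -!natrM ler_nat.
  rewrite -(leq_pmul2l (isT : (0 < 2)%N)) mulnCA sum_hit_count // -/Om mulnC mulnCA leq_mul2l.
  by rewrite -expnS ltnW // orbT.
pose g := (l - s)%N.
have split_cost w : (if covers (drawn w) j then (trunc_log 2 (hit_count (drawn w) j))%:R else W)
    <= g%:R + (hit_count (drawn w) j)%:R / 2 ^+ g + (~~ covers (drawn w) j)%:R * W :> R.
  case: ifP => _ /=; rewrite ?mul0r ?addr0 ?mul1r; first exact: trunc_log2_le_affine.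
  by rewrite lerDr addr_ge0 ?ler0n // divr_ge0 ?ler0n // ltW.
apply: (@le_trans _ _ (\sum_(w : draw (2 ^ s)) (g%:R + (hit_count (drawn w) j)%:R / 2 ^+ g
                                              + (~~ covers (drawn w) j)%:R * W))).
  by apply: ler_sum => w _; apply: split_cost.
rewrite !big_split /= -!mulr_suml sumr_const -/Om -[g%:R *+ _]mulr_natl.
have card_miss : \sum_(w : draw (2 ^ s)) (~~ covers (drawn w) j)%:R
    = #|[set w : draw (2 ^ s) | ~~ covers (drawn w) j]|%:R :> R.
  rewrite -natr_sum -sum1_card [in RHS]big_mkcond; congr (_%:R); apply: eq_bigr => w _.
  by rewrite inE; case: ifP.
rewrite card_miss; case: ifP => [le_sl|/negbT]; last rewrite -ltnNge => lt_ls.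
  have miss : #|[set w : draw (2 ^ s) | ~~ covers (drawn w) j]|%:R <= 3 / 4 * Om%:R :> R.
    have := @card_not_covers (2 ^ s) j; rewrite n0 (leq_trans _ le_l) ?leq_exp2l // => /(_ isT).
    by rewrite -/Om -(ler_nat R) !natrM; lra.
  have hits : (\sum_(w : draw (2 ^ s)) (hit_count (drawn w) j)%:R) / 2 ^+ g <= Om%:R :> R.
    rewrite ler_pdivrMr // (le_trans mean_hits) // /g.
    by rewrite -{1}(subnK le_sl) exprD mulfK ?gt_eqF.
  by move: hits (ler_wpM2r W0 miss); rewrite -/g; lra.
have g0 : g = 0%N by apply/eqP; rewrite subn_eq0 ltnW.
have miss : #|[set w : draw (2 ^ s) | ~~ covers (drawn w) j]|%:R <= Om%:R :> R.
  by rewrite ler_nat max_card.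
rewrite g0 mulr0 add0r expr0 divr1 mulrDr lerD //.
exact: ler_wpM2r.
Qed.

(** Method of conditional expectations: some first draw does no worse than the mean, and the others
    are chosen recursively for the columns it leaves uncovered. *)
Lemma exists_draws V ss (S : {set T}) : 0 <= V -> (forall j, (0 < degree j)%N) ->
  exists2 xs : seq {set T}, size xs = size ss &
    \sum_(j in S) cover_cost V xs j <= \sum_(j in S) potential V ss (trunc_log 2 (degree j)).
Proof.
move=> V0 d0; elim: ss S => [|s ss IH] S; first by exists [::].
pose f (w : draw (2 ^ s)) := \sum_(j in S)
  (if covers (drawn w) j then (trunc_log 2 (hit_count (drawn w) j))%:R
   else potential V ss (trunc_log 2 (degree j))).
pose t := \sum_(j in S) potential V (s :: ss) (trunc_log 2 (degree j)).
have [w fw] : exists w, f w <= t.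
  apply/existsP; apply: contraT; rewrite negb_exists => /forallP lt_tf.
  have draw0 : (0 < #|draw (2 ^ s)|)%N by rewrite card_draw muln_gt0 !expn_gt0.
  have : \sum_(w : draw (2 ^ s)) t < \sum_w f w.
    have [w0 _] := card_gt0P draw0.
    apply: ltr_sum => [|w _]; last by rewrite ltNge.
    by apply/hasP; exists w0; rewrite ?mem_index_enum.
  rewrite sumr_const -mulr_natl /f exchange_big /= /t mulr_sumr ltNge => /negP[].
  by apply: ler_sum => j _; apply: mean_cover_cost => //; apply: trunc_log_bounds.
have [xs sz_xs le_xs] := IH [set j in S | ~~ covers (drawn w) j].
exists (drawn w :: xs); first by rewrite /= sz_xs.
apply: le_trans fw; rewrite /f /= [leLHS](bigID (covers (drawn w))) [leRHS](bigID (covers (drawn w))) /=.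
rewrite [X in X + _](eq_bigr (fun j => (trunc_log 2 (hit_count (drawn w) j))%:R)); last by move=> j /andP[_ ->].
rewrite [X in _ <= X + _](eq_bigr (fun j => (trunc_log 2 (hit_count (drawn w) j))%:R)); last by move=> j /andP[_ ->].
rewrite lerD2l (eq_bigr (cover_cost V xs)) => [|j /andP[_ /negPf -> //]].
rewrite [leRHS](eq_bigr (fun j => potential V ss (trunc_log 2 (degree j)))) => [|j /andP[_ /negPf -> //]].
by move: le_xs; rewrite !(eq_bigl _ _ (in_set _)).
Qed.

(** With [L = trunc_log 2 k + 1] this is [L + 3 * (L + 5)]: exponents [L - 1] down to [0], then
    [3 * (L + 5)] further zeros. *)
Definition sweep_length (k : nat) : nat := 4 * trunc_log 2 k + 19.

Lemma potential_zeros V A l : 0 <= V -> (3 / 4) ^+ A * V <= 1 ->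
  potential V (nseq A 0%N) l <= 4 * l%:R + 5.
Proof.
move=> V0 small.
have : potential V (nseq A 0%N) l <= 4 * (l%:R + 1) + (3 / 4) ^+ A * V.
  elim: A {small} => [|A IH] /=; last first.
    have -> : (3 / 4) ^+ A.+1 * V = 3 / 4 * ((3 / 4) ^+ A * V) by rewrite exprS mulrA.
    by rewrite subn0; move: IH; set u := _ ^+ A * V; set v := potential _ _ _; lra.
  by rewrite expr0 mul1r; have := ler0n R l; lra.
by move: small; set u := _ ^+ A * V; lra.
Qed.

(** Draws too sparse for the column, [s > l], add a geometric series of sum at most [1]. For the
    others, one step of the recursion carries the bound [4 * (l - s) + 20] exactly from [s] to
    [s + 1]. *)
Lemma potential_sweep V A l L : (l < L)%N -> 0 <= V -> (3 / 4) ^+ A * V <= 1 ->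
  potential V (rev (iota 0 L) ++ nseq A 0%N) l <= 18.
Proof.
move=> lt_lL V0 small.
have low s : (s <= l.+1)%N ->
    potential V (rev (iota 0 s) ++ nseq A 0%N) l <= 4 * (l%:R - s%:R) + 20.
  elim: s => [_|s IH le_sl]; first by have := potential_zeros l V0 small; rewrite /= subr0; lra.
  rewrite -addn1 iotaD rev_cat /= add0n -ltnS le_sl natrB // natrD.
  by move: (IH (ltnW le_sl)); lra.
have p2 k : 0 < 2 ^+ k :> R by rewrite exprn_gt0.
have high g : potential V (rev (iota 0 (l.+1 + g)) ++ nseq A 0%N) l <= 18 - 1 / 2 ^+ g.
  elim: g => [|g IH]; first by move: (low _ (leqnn _)); rewrite addn0 expr0 -natr1; lra.
  rewrite addnS -addn1 iotaD rev_cat /= add0n leqNgt addSn ltnS leq_addr /= -addSn.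
  have -> : 2 ^+ l / 2 ^+ (l.+1 + g) = 1 / 2 ^+ g.+1 :> R.
    by rewrite addSnnS exprD invfM mulrA divff ?gt_eqF.
  have -> : 1 / 2 ^+ g.+1 = 1 / 2 ^+ g / 2 :> R by rewrite exprSr invfM mulrA.
  lra.
rewrite -(subnKC lt_lL); apply: le_trans (high _) _.
by rewrite lerBlDr lerDl divr_ge0 // ltW.
Qed.

End RandomRows.

(* The bound controls the total number of bits of the coefficients seen at the
   first draw covering each column. *)
Lemma exists_sweep (T : finType) (E : fieldType) (eps : T -> T -> int) :
    (forall i j, (`|eps i j| <= 1)%N) -> (forall j, eps j j != 0) ->
  exists xs : seq {set T},
    [/\ size xs = sweep_length #|T|,
        forall j, has (fun x => covers E eps x j) xs &
        (\sum_j trunc_log 2 (hit_count eps (nth set0 xs (find (fun x => covers E eps x j) xs)) j)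
           <= 18 * #|T|)%N].
Proof.
move=> eps_small eps_diag.
have [R _] : exists R : realFieldType, True by exists rat.
have d0 j : (0 < degree eps j)%N by apply/card_gt0P; exists j; rewrite inE.
(* As [2 ^ L > #|T|] and [(3 / 4) ^ 3 < 1 / 2], the last [A] draws shrink the penalty [V] to at most
   [1]. Since [V] exceeds the total budget [18 * #|T|], no column can stay uncovered. *)
pose L := (trunc_log 2 #|T|).+1; pose A := (3 * (L + 5))%N.
pose V : R := (18 * #|T|).+1%:R.
have V0 : 0 <= V by exact: ler0n.
have small : (3 / 4) ^+ A * V <= 1.
  have le_half : (3 / 4) ^+ A <= (2^-1) ^+ (L + 5) :> R.
    have q0 : 0 <= 3 / 4 :> R by lra.
    have h0 : 0 <= 2^-1 :> R by lra.
    by rewrite exprM lerXn2r ?nnegrE ?exprn_ge0 // !exprS expr0; lra.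
  apply: le_trans (ler_wpM2r V0 le_half) _.
  rewrite exprVn mulrC ler_pdivrMr ?exprn_gt0 // mul1r -natrX ler_nat expnD.
  by have := trunc_log_ltn #|T| (isT : (1 < 2)%N); rewrite -/L; lia.
have [xs sz_xs cost_xs] := exists_draws E eps_small
   (rev (iota 0 L) ++ nseq A 0%N) [set: T] V0 d0.
have {}cost_xs : \sum_j cover_cost E eps V xs j <= (18 * #|T|)%:R.
  move: cost_xs; under eq_bigl do rewrite inE.
  under [X in _ <= X]eq_bigl do rewrite inE.
  move=> /le_trans; apply; rewrite natrM mulr_natr -sumr_const; apply: ler_sum => j _.
  apply: potential_sweep => //; rewrite /L ltnS; apply: leq_trunc_log.
  exact: max_card.
have cov j : has (fun x => covers E eps x j) xs.
  apply: contraT => /hasPn nocov.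
  have -> : false = (V <= (18 * #|T|)%:R) by rewrite ler_nat ltnn.
  apply: le_trans cost_xs; rewrite (bigD1 j) //= -[leLHS]addr0 lerD ?sumr_ge0 //; last first.
    by move=> i _; apply: cover_cost_ge0.
  elim: xs nocov {sz_xs} => [|x xs IH] //= nocov.
    rewrite (negPf (nocov x _)) ?mem_head // IH // => y yx.
    by rewrite nocov // inE yx orbT.
exists xs; split=> //.
  by rewrite sz_xs size_cat size_rev size_iota size_nseq /sweep_length /A /L; lia.
rewrite -(ler_nat R) natr_sum; apply: le_trans cost_xs; apply: ler_sum => j _.
move: (cov j); elim: xs {sz_xs cov} => [|x xs IH] //=.
by case: ifP => //= _; apply: IH.
Qed.

(** * Relations in an irredundant cover *)

Lemma Fp_character (p : nat) : prime p ->
  exists chi : 'F_p -> algC,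
    [/\ chi 0 = 1, {morph chi : a b / a + b >-> a * b}, injective chi
      & forall a, (chi a)^* = chi (- a)].
Proof.
move=> p_pr; have [z prim_z] := C_prim_root_exists (prime_gt0 p_pr).
have zp : z ^+ p = 1 by apply: prim_expr_order.
pose chi (a : 'F_p) := z ^+ a.
have chi0 : chi 0 = 1 by [].
have chiD : {morph chi : a b / a + b >-> a * b}.
  move=> a b; rewrite /chi -exprD -[RHS](expr_mod _ zp); congr (_ ^+ _).
  by congr modn; apply: Fp_cast.
have chiN a : chi (- a) * chi a = 1 by rewrite -chiD addNr.
have norm_chi a : `|chi a| = 1.
  apply/eqP; rewrite -(pexpr_eq1 (prime_gt0 p_pr)) ?normr_ge0 //.
  by rewrite -normrX -exprM mulnC exprM zp expr1n normr1.
exists chi; split=> //.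
  move=> a b /eqP; rewrite (eq_prim_root_expr prim_z) => /eqP eab; apply: val_inj.
  have lt_p (c : 'F_p) : (c < p)%N by rewrite -[X in (_ < X)%N](Fp_cast p_pr).
  by move: eab; rewrite !modn_small.
move=> a; have nz : chi a != 0 by rewrite -normr_eq0 norm_chi oner_neq0.
by apply: (mulIf nz); rewrite chiN mulrC -normCK norm_chi expr1n.
Qed.

(* [P], the product of the factors [1 - chi (f j - b j)] for [j != i], is supported
   on [f i = b i], so translation by [f i] preserves its set of frequencies, and
   these are subset sums of the [f j]. *)
Lemma irredundant_cover_relation (p : nat) (V : finZmodType) (T : finType)
    (f : T -> V -> 'F_p) (b : T -> 'F_p) (i : T) :
    prime p -> (forall j, {morph f j : x y / x + y}) ->
    (forall x, exists j, f j x = b j) ->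
    (exists x, forall j, j != i -> f j x != b j) ->
  exists J J' : {set T}, [/\ i \notin J, i \notin J' &
    forall x, f i x = \sum_(j in J) f j x - \sum_(j in J') f j x].
Proof.
move=> p_pr fD cov [x0 x0P].
have [chi [chi0 chiD chi_inj chi_conj]] := Fp_character p_pr.
pose sum_f (J : {set T}) x : 'F_p := \sum_(j in J) f j x.
(* The value [0] at [i] makes the [i]-th factor of [P] equal to [1] and kills every subset
   containing [i]. *)
pose coef (J : {set T}) : algC := \prod_(j in J) (if j == i then 0 else - chi (- b j)).
pose P x : algC := \prod_j (1 - (if j == i then 0 else chi (f j x - b j))).
have chi_sum (I : finType) (J : {set I}) (g : I -> 'F_p) :
    chi (\sum_(j in J) g j) = \prod_(j in J) chi (g j).
  by apply: (big_morph chi chiD chi0).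
have coef_i (J : {set T}) : i \in J -> coef J = 0 by move=> iJ; rewrite /coef (bigD1 i) //= eqxx mul0r.
have P_expand x : P x = \sum_(J : {set T}) coef J * chi (sum_f J x).
  rewrite /P (eq_bigr (fun j => (- (if j == i then 0 else chi (f j x - b j))) + 1)); last first.
    by move=> j _; rewrite addrC.
  rewrite bigA_distr; apply: eq_bigr => J _.
  rewrite -big_mkcond /= /coef chi_sum -big_split /=; apply: eq_bigr => j _.
  by case: ifP => _; rewrite ?mul0r ?oppr0 // mulNr -chiD addrC.
have P_eq0 x : f i x != b i -> P x = 0.
  move=> fi; have [j fj] := cov x.
  have ji : j != i by apply: contraNneq fi => <-; rewrite fj.
  by rewrite /P (bigD1 j) //= (negPf ji) fj subrr chi0 subrr mul0r.
have P_x0 : P x0 != 0.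
  apply/prodf_neq0 => j _; case: (eqVneq j i) => [_|ji]; first by rewrite subr0 oner_neq0.
  rewrite subr_eq0 eq_sym -chi0 (inj_eq chi_inj) subr_eq0; exact: x0P.
pose hat (mu : V -> 'F_p) : algC := \sum_x P x * chi (- mu x).
(* Orthogonality: if [mu] differs from [sum_f J] at [v], translation by [v] multiplies the inner sum
   by a scalar other than [1], so it vanishes. *)
have hat_freq (mu : V -> 'F_p) : {morph mu : x y / x + y} -> hat mu != 0 ->
    exists2 J : {set T}, i \notin J & forall x, mu x = sum_f J x.
  move=> muD; case: (boolP [exists J : {set T}, (i \notin J) && [forall x, mu x == sum_f J x]]).
    by move=> /existsP[J /andP[iJ /forallP muJ]] _; exists J => // x; apply/eqP.
  rewrite negb_exists => /forallP noJ /eqP[].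
  rewrite /hat (eq_bigr (fun x => \sum_(J : {set T}) coef J * chi (sum_f J x - mu x))); last first.
    by move=> x _; rewrite P_expand mulr_suml; apply: eq_bigr => J _; rewrite chiD mulrA.
  rewrite exchange_big big1 //= => J _; rewrite -mulr_sumr.
  have := noJ J; rewrite negb_and negbK => /orP[/coef_i -> |]; first by rewrite mul0r.
  rewrite negb_forall => /existsP[v muv]; set S := \sum_x _.
  have : S = chi (sum_f J v - mu v) * S.
    rewrite {1}/S (reindex_inj (addrI v)) /S mulr_sumr; apply: eq_bigr => x _.
    rewrite -chiD muD /sum_f; congr chi.
    by rewrite (eq_bigr (fun j => f j v + f j x)) ?big_split /= => [|j _]; [ring | apply: fD].
  move/eqP; rewrite -subr_eq0 -{1}[S]mul1r -mulrBl mulf_eq0 subr_eq0 eq_sym -chi0 (inj_eq chi_inj).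
  by rewrite subr_eq0 eq_sym (negPf muv) => /eqP ->; rewrite mulr0.
have sum_fD J : {morph sum_f J : x y / x + y}.
  by move=> x y; rewrite /sum_f -big_split; apply: eq_bigr => j _; apply: fD.
(* Parseval's argument: otherwise the sum of the [|P x| ^ 2] would vanish, against [P x0 != 0]. *)
have [J hatJ] : exists J, hat (sum_f J) != 0.
  apply/existsP; apply: contraT; rewrite negb_exists => /forallP hat0.
  have : \sum_x `|P x| ^+ 2 = 0.
    rewrite (eq_bigr (fun x => \sum_(J : {set T}) (coef J)^* * (P x * chi (- sum_f J x)))); last first.
      move=> x _; rewrite normCK {2}P_expand rmorph_sum mulr_sumr; apply: eq_bigr => J _.
      by rewrite rmorphM /= chi_conj mulrCA.
    rewrite exchange_big big1 //= => J _; rewrite -mulr_sumr.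
    by have /negPn/eqP := hat0 J; rewrite /hat => ->; rewrite mulr0.
  move/eqP; rewrite psumr_eq0; last by move=> x _; rewrite exprn_ge0.
  move=> /allP /(_ x0); rewrite mem_index_enum => /(_ isT).
  by rewrite expf_eq0 /= normr_eq0 (negPf P_x0).
(* [J] may contain [i], so its function is rewritten as a subset sum avoiding [i]. As [f i] is the
   constant [b i] on the support of [P], subtracting [f i] only changes [hat] by a nonzero factor
   and gives a second frequency. *)
have [J1 iJ1 J1P] := hat_freq _ (sum_fD J) hatJ.
have [J2 iJ2 J2P] : exists2 J' : {set T}, i \notin J' & forall x, sum_f J x - f i x = sum_f J' x.
  apply: hat_freq; first by move=> x y; rewrite sum_fD fD; ring.
  apply: contraNneq hatJ => hat0.
  have -> : hat (sum_f J) = chi (- b i) * hat (fun x => sum_f J x - f i x).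
    rewrite /hat mulr_sumr; apply: eq_bigr => x _.
    have [fi|/P_eq0 ->] := eqVneq (f i x) (b i); last by rewrite !mul0r mulr0.
    by rewrite mulrCA -chiD fi; congr (_ * chi _); ring.
  by rewrite hat0 mulr0.
exists J1, J2; split=> // x; rewrite -/(sum_f J1 x) -/(sum_f J2 x) -J1P -J2P; ring.
Qed.

(** * Counting records *)

(* In the order given by [tau], ties broken arbitrarily, the entries of [t] at
   vectors outside the span of their predecessors are determined by the others. *)
Lemma card_triangular_solutions (K : finFieldType) (W : vectType K) (T : finType)
    (v : T -> W) (tau : T -> nat) (c : T -> K) : (forall j, c j != 0) ->
  (#|[set t : {ffun T -> K} | [forall j, t j != 0%R] &&
      [forall j, (\sum_(i | tau i == tau j) (c i * t i) *: v i)%R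
         \in <<[seq v i | i in [pred i | tau i < tau j]]>>%VS]]|
   * #|K|.-1 ^ \dim <<[seq v i | i in T]>>%VS <= #|K|.-1 ^ #|T|)%N.
Proof.
move=> c0; set A := [set t | _].
pose key j := (tau j * #|T| + enum_rank j)%N.
have key_tau i j : (tau i < tau j)%N -> (key i < key j)%N.
  move=> lt_ij; rewrite /key; apply: (@leq_trans ((tau i).+1 * #|T|)).
    by rewrite mulSn addnC ltn_add2r.
  by rewrite (leq_trans _ (leq_addr _ _)) // leq_mul2r lt_ij orbT.
have key_inj i j : tau i = tau j -> key i = key j -> i = j.
  by rewrite /key => -> /addnI /val_inj /enum_rank_inj.
(* The greedy basis for the order [key]. *)
pose I := [set j | v j \notin <<[seq v i | i in [pred i | key i < key j]%N]>>%VS].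
have v_spanI j : v j \in <<[seq v i | i in I]>>%VS.
  have [n] := ubnP (key j); elim: n j => // n IH j lt_jn.
  have [jI|] := boolP (j \in I); first by rewrite memv_span // image_f.
  rewrite inE negbK; apply: subvP; apply/span_subvP => w /imageP[i + ->].
  by rewrite inE => lt_ij; apply: IH; apply: leq_trans lt_ij _.
have dim_le : (\dim <<[seq v i | i in T]>>%VS <= #|I|)%N.
  apply: (@leq_trans (\dim <<[seq v i | i in I]>>%VS)).
    by apply/dimvS/span_subvP => w /imageP[i _ ->].
  by rewrite (leq_trans (dim_span _)) // size_map -cardE.
pose g (t : {ffun T -> K}) := [ffun j => if j \in I then 1 else t j].
have g_inj : {in A &, injective g}.
  move=> t t' tA t'A eq_g; apply/ffunP => j0; apply/eqP; apply: contraT => neq0.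
  (* At the [key]-last index [j] of this tie class where [t] and [t'] differ, subtracting the two
     memberships puts [v j] in the span of its predecessors, although [j] lies in [I]. *)
  pose D := [pred i | (tau i == tau j0) && (t i != t' i)].
  have Dj0 : D j0 by rewrite inE /= eqxx.
  have [j /andP[/eqP tau_j neq_j] max_j] := arg_maxnP key Dj0.
  have jI : j \in I.
    apply: contraNT neq_j => jI; have := congr1 (fun h : {ffun T -> K} => h j) eq_g.
    by rewrite !ffunE (negPf jI) => ->.
  move: (tA) (t'A); rewrite !inE => /andP[_ /forallP /(_ j) t_span] /andP[_ /forallP /(_ j) t'_span].
  have := rpredB t_span t'_span; rewrite -sumrB.
  under eq_bigr => i _ do rewrite -scalerBl -mulrBr.
  rewrite (bigD1 j) //= => sum_in.
  move: jI; rewrite inE => /negP[].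
  set U := <<_>>%VS.
  have cj : c j * (t j - t' j) != 0 by rewrite mulf_neq0 // subr_eq0.
  suff : (c j * (t j - t' j)) *: v j \in U.
    by move/(rpredZ (c j * (t j - t' j))^-1); rewrite scalerA mulVf // scale1r.
  rewrite -[_ *: _](addrK (\sum_(i | (tau i == tau j) && (i != j)) (c i * (t i - t' i)) *: v i)).
  apply: rpredB.
    apply: subvP sum_in; apply/span_subvP => w /imageP[i + ->]; rewrite inE => lt_ij.
    by rewrite memv_span // image_f // inE key_tau.
  apply: rpred_sum => i /andP[/eqP tau_i ij].
  have [->|neq_i] := eqVneq (t i) (t' i); first by rewrite subrr mulr0 scale0r mem0v.
  rewrite rpredZ // memv_span // image_f // inE ltn_neqAle.
  have -> : (key i <= key j)%N by apply: max_j; rewrite inE /= tau_i tau_j eqxx.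
  by rewrite andbT; apply: contraNneq ij => /key_inj ->.
rewrite -(card_in_imset g_inj).
have nz : #|[set a : K | a != 0]| = #|K|.-1.
  by rewrite -(cardC1 (0 : K)); apply: eq_card => a; rewrite !inE.
have le_card : (#|g @: A| <= #|K|.-1 ^ #|~: I|)%N.
  apply: (@leq_trans #|[set t : {ffun T -> K} | [forall i, if i \in I then t i == 1 else t i != 0]]|).
    apply/subset_leq_card/subsetP => _ /imsetP[t + ->]; rewrite !inE => /andP[/forallP t0 _].
    by apply/forallP => i; rewrite ffunE; case: (i \in I); rewrite ?eqxx ?t0.
  rewrite (card_ffun_forall (fun i => [pred a : K | if i \in I then a == 1 else a != 0])).
  rewrite (bigID (mem I)) /= big1 => [|i iI]; last first.
    by rewrite -(cards1 (1 : K)); apply: eq_card => a; rewrite in_set /= iI in_set1.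
  rewrite mul1n (eq_bigr (fun=> #|K|.-1)) => [|i /negPf iI]; last first.
    by rewrite -nz; apply: eq_card => a; rewrite in_set /= iI in_set.
  by rewrite prod_nat_const leq_eqVlt; apply/orP; left; apply/eqP; congr (_ ^ _)%N; apply: eq_card => i; rewrite in_setC.
have q1 : (0 < #|K|.-1)%N by rewrite -subn1 subn_gt0 finNzRing_gt1.
rewrite -(cardsC I) expnD mulnC leq_mul // leq_pexp2l //.
Qed.

Lemma sum_inverse_squares (R : realFieldType) (n : nat) : \sum_(a < n) ((a.+1%:R : R) ^+ 2)^-1 <= 2.
Proof.
suff : \sum_(a < n.+1) ((a.+1%:R : R) ^+ 2)^-1 <= 2 - (n.+1%:R)^-1.
  rewrite big_ord_recr /= => /(le_trans _) h.
  have -> : (2 : R) = 2 - n.+1%:R^-1 + n.+1%:R^-1 by ring.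
  have n0 : 0 < (n.+1%:R : R) by rewrite ltr0n.
  apply: le_trans (_ : 2 - n.+1%:R^-1 <= _); last by rewrite lerDl invr_ge0 ltW.
  by apply: h; rewrite lerDl invr_ge0 exprn_ge0 // ltW.
elim: n => [|n IH]; first by rewrite big_ord1 /= expr1n invr1; lra.
rewrite big_ord_recr /=; apply: (le_trans (lerD IH (lexx _))).
have x0 : 0 < (n.+1%:R : R) by rewrite ltr0n.
rewrite -(natr1 n.+1); move: (n.+1%:R) x0 => x x0.
rewrite -subr_ge0; have -> : 2 - (x + 1)^-1 - (2 - x^-1 + ((x + 1) ^+ 2)^-1) = (x * (x + 1) ^+ 2)^-1.
  by field; apply/andP; split; lra.
by rewrite invr_ge0 mulr_ge0 ?exprn_ge0 // ?addr_ge0 // ltW.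
Qed.

(** Give a magnitude [a] the weight [1 / (a + 1) ^ 2]. All functions together weigh at most
    [4 ^ #|T|], and each counted one at least [4 ^ (- (C + 1) * #|T|)]. *)
Lemma card_cheap_coefs (T : finType) (M C : nat) :
  (#|[set z : {ffun T -> bool * 'I_M} | \sum_j trunc_log 2 (z j).2 <= C * #|T|]|
     <= 4 ^ (C.+2 * #|T|))%N.
Proof.
have [R _] : exists R : realFieldType, True by exists rat.
set Z := [set z | _].
pose u (a : nat) : R := (a.+1%:R ^+ 2)^-1.
have u_ge a : (4 ^+ (trunc_log 2 a).+1)^-1 <= u a.
  rewrite /u lef_pV2 ?posrE ?exprn_gt0 ?ltr0n //.
  have -> : 4 = 2 ^+ 2 :> R by rewrite -natrX.
  rewrite -exprM mulnC exprM -!natrX ler_nat.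
  by rewrite leq_exp2r // trunc_log_ltn.
have u0 a : 0 <= u a by rewrite invr_ge0 exprn_ge0.
have p4 n : 0 < 4 ^+ n :> R by rewrite exprn_gt0.
have mass : \sum_(z : {ffun T -> bool * 'I_M}) \prod_j u (z j).2 <= 4 ^+ #|T|.
  rewrite -(bigA_distr_bigA (fun _ (e : bool * 'I_M) => u e.2)) /= prodr_const.
  rewrite lerXn2r ?nnegrE ?sumr_ge0 //.
  rewrite -(pair_big xpredT xpredT (fun _ (a : 'I_M) => u a)) /= big_bool /=.
  by have := sum_inverse_squares R M; rewrite -/u; lra.
rewrite -(ler_nat R) natrX.
have -> : 4 ^+ (C.+2 * #|T|) = 4 ^+ #|T| * 4 ^+ (C.+1 * #|T|) :> R.
  by rewrite -exprD -mulSn.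
rewrite -ler_pdivrMr //; apply: le_trans mass.
rewrite [leRHS](bigID (mem Z)) /= -[leLHS]addr0 lerD ?sumr_ge0 //; last first.
  by move=> z _; rewrite prodr_ge0.
rewrite mulr_natl -sumr_const; apply: ler_sum => z; rewrite inE => zZ.
apply: (@le_trans _ _ (\prod_j (4 ^+ (trunc_log 2 (z j).2).+1)^-1)); last first.
  by apply: ler_prod => j _; rewrite u_ge invr_ge0 ltW.
rewrite prodfV lef_pV2 ?posrE ?prodr_gt0 // prodrXr.
rewrite ler_eXn2l ?ltr1n //.
rewrite (eq_bigr (fun j => trunc_log 2 (z j).2 + 1)%N) => [|j _]; last by rewrite addn1.
by rewrite big_split /= sum1_card mulSn addnC leq_add2l.
Qed.

(** * The rank of an irredundant cover *)

Section IrredundantCover.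
Variables (p : nat) (V : finZmodType) (T : finType).
Variables (f : T -> {ffun V -> ('F_p)^o}) (b : T -> 'F_p).
Hypotheses (p_pr : prime p) (f_add : forall j, {morph f j : x y / x + y}).
Hypothesis f_cover : forall x, exists j, f j x = b j.
Hypothesis f_irred : forall i, exists x, forall j, j != i -> f j x != b j.

Let k := #|T|.
Let B := sweep_length k.

(** The equations [t j * f j = t j * b j] define the same irredundant cover. Moving the [i]-th form
    to the other side of its relation puts [-1] on the diagonal. *)
Lemma scaled_relations (t : T -> 'F_p) : (forall j, t j != 0) ->
  exists eps : T -> T -> int,
    [/\ forall i j, (`|eps i j| <= 1)%N, forall j, eps j j != 0 &
        forall i, \sum_j ((eps i j)%:~R * t j) *: f j = 0].
Proof.
move=> t0.
have rel i : exists JJ : {set T} * {set T}, [/\ i \notin JJ.1, i \notin JJ.2 &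
    forall x, t i * f i x = \sum_(j in JJ.1) t j * f j x - \sum_(j in JJ.2) t j * f j x].
  have [|||J [J' H]] := @irredundant_cover_relation p V T (fun j x => t j * f j x)
     (fun j => t j * b j) i p_pr; last by exists (J, J'); case: H.
  - by move=> j x y; rewrite f_add mulrDr.
  - by move=> x; have [j fj] := f_cover x; exists j; rewrite fj.
  have [x xP] := f_irred i; exists x => j ji.
  by rewrite (inj_eq (mulfI (t0 j))) xP.
have [JJ JJP] := fin_all_exists rel.
exists (fun i j => (j \in (JJ i).1)%:R - (j \in (JJ i).2)%:R - (j == i)%:R); split.
- move=> i j; have [iJ iJ' _] := JJP i.
  case: eqVneq => [->|_]; first by rewrite (negPf iJ) (negPf iJ').
  by case: (_ \in _); case: (_ \in _).
- by move=> j; have [iJ iJ' _] := JJP j; rewrite eqxx (negPf iJ) (negPf iJ').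
move=> i; apply/ffunP => x; rewrite sum_ffunE ffunE.
have [_ _ /(_ x) eq_i] := JJP i.
have bool_sum (J : pred T) : \sum_(j | J j) t j * f j x = \sum_j (J j)%:R * t j * f j x.
  by rewrite big_mkcond; apply: eq_bigr => j _; case: (J j); rewrite ?mul1r ?mul0r.
have one_sum : t i * f i x = \sum_j (j == i)%:R * t j * f j x.
  by rewrite -(bool_sum (pred1 i)) big_pred1_eq.
transitivity (\sum_j (((j \in (JJ i).1)%:R * t j * f j x - (j \in (JJ i).2)%:R * t j * f j x)
               - (j == i)%:R * t j * f j x)).
  apply: eq_bigr => j _; rewrite ffunE !rmorphB /= !rmorph_nat.
  by rewrite -!mulrBl.
by rewrite !sumrB -one_sum -!bool_sum eq_i subrr.
Qed.

Definition signed_coef (M : nat) (e : bool * 'I_M) : 'F_p :=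
  if e.1 then - (e.2 : nat)%:R else (e.2 : nat)%:R.

(** The scalars compatible with a record: [code.1 j] stands for the time at which [j] is first
    covered, [code.2 j] for its coefficient then, in sign and magnitude. *)
Let solutions (code : {ffun T -> 'I_B} * {ffun T -> bool * 'I_k.+1}) : {set {ffun T -> 'F_p}} :=
  [set t : {ffun T -> 'F_p} | [forall j, t j != 0] &&
      [forall j, \sum_(i | code.1 i == code.1 j :> nat) (signed_coef (code.2 i) * t i) *: f i
         \in <<[seq f i | i in [pred i | (code.1 i < code.1 j)%N]]>>%VS]].

(** In the relation first covering [j], indices of later time have coefficient [0] and those of
    earlier time contribute to the span only, so the recorded combination of the same time lies in
    that span. *)
Lemma exists_code (t : {ffun T -> 'F_p}) : (forall j, t j != 0) ->
  exists code, [/\ t \in solutions code,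
    forall j, signed_coef (code.2 j) != 0 &
    (\sum_j trunc_log 2 (code.2 j).2 <= 18 * k)%N].
Proof.
move=> t0; have [eps [eps_small eps_diag eps_rel]] := scaled_relations t0.
have [xs [sz_xs cov cost]] := exists_sweep 'F_p eps_small eps_diag.
pose cv j := fun x => covers 'F_p eps x j.
pose time j := find (cv j) xs.
have time_lt j : (time j < B)%N by rewrite /B /k -sz_xs -has_find; apply: cov.
pose x_ n := nth set0 xs n.
pose z j := rel_coef eps (x_ (time j)) j.
have z_le j : (`|z j| <= hit_count eps (x_ (time j)) j)%N by apply: rel_coef_le.
have z_lt j : (`|z j| < k.+1)%N by rewrite ltnS (leq_trans (z_le j)) ?max_card.
pose code2 := [ffun j => (z j < 0, Ordinal (z_lt j))].
pose code1 := [ffun j => Ordinal (time_lt j)].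
have coef_z j : signed_coef (code2 j) = (z j)%:~R.
  rewrite /signed_coef ffunE /=; case: ifP => [neg|/negbT].
    by rewrite pmulrn abszE ltr0_norm // mulrNz opprK.
  by rewrite -leNgt => z0; rewrite pmulrn abszE ger0_norm.
exists (code1, code2); split=> /=; last first.
- apply: leq_trans cost; apply: leq_sum => j _; rewrite ffunE /=.
  by apply: leq_trunc_log.
- by move=> j; rewrite coef_z; apply: nth_find (cov j).
rewrite inE /=; apply/andP; split; apply/forallP => // j.
pose x := x_ (time j).
have zero_sum : \sum_i ((rel_coef eps x i)%:~R * t i) *: f i = 0.
  rewrite (eq_bigr (fun i => \sum_(h in x) ((eps h i)%:~R * t i) *: f i)).
    by rewrite exchange_big big1 // => h _; apply: eps_rel.
  by move=> i _; rewrite /rel_coef rmorph_sum mulr_suml scaler_suml.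
rewrite (eq_bigl (fun i => time i == time j)); last by move=> i; rewrite !ffunE.
rewrite (eq_bigr (fun i => ((rel_coef eps x i)%:~R * t i) *: f i)); last first.
  by move=> i /eqP ti; rewrite coef_z /z ti.
move: zero_sum; rewrite (bigID (fun i => time i == time j)) /= => /eqP.
rewrite addr_eq0 => /eqP ->; rewrite rpredN; apply: rpred_sum => i neq_time.
have [lt_ij|] := ltnP (time i) (time j).
  by rewrite rpredZ // memv_span // image_f // inE !ffunE.
rewrite leq_eqVlt eq_sym (negPf neq_time) /= => lt_ji.
have := before_find set0 lt_ji; rewrite /cv /covers => /negbFE /eqP.
by rewrite -/(x_ _) -/x => ->; rewrite mul0r scale0r mem0v.
Qed.

(** Double counting: each of the [(p - 1) ^ k] nowhere zero [t] has a cheap record, and a record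
    serves at most [(p - 1) ^ (k - rho)] of them. The [20] is [18 + 2], from [card_cheap_coefs]. *)
Lemma irredundant_cover_rank (c : nat) : (20 <= c)%N ->
  (p.-1 ^ \dim <<[seq f i | i in T]>>%VS <= (4 ^ c * B) ^ k)%N.
Proof.
move=> c_ge; set rho := \dim _.
have card_F : #|'F_p| = p by rewrite card_Fp.
have p1 : (0 < p.-1)%N by rewrite -subn1 subn_gt0 prime_gt1.
pose good := [set code : {ffun T -> 'I_B} * {ffun T -> bool * 'I_k.+1} |
   [forall j, signed_coef (code.2 j) != 0] && (\sum_j trunc_log 2 (code.2 j).2 <= 18 * k)%N].
have card_good : (#|good| <= (4 ^ c * B) ^ k)%N.
  apply: (@leq_trans #|setX [set: {ffun T -> 'I_B}]
     [set z : {ffun T -> bool * 'I_k.+1} | \sum_j trunc_log 2 (z j).2 <= 18 * k]%N|).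
    by apply/subset_leq_card/subsetP => -[tau z]; rewrite !inE /= => /andP[].
  rewrite cardsX cardsT card_ffun card_ord -/k expnMn mulnC leq_mul2r -expnM.
  by rewrite (leq_trans (card_cheap_coefs T k.+1 18)) ?orbT // leq_exp2l // leq_mul2r c_ge orbT.
pose Tn := [set t : {ffun T -> 'F_p} | [forall j, t j != 0]].
have card_Tn : #|Tn| = (p.-1 ^ k)%N.
  have := card_ffun_forall (fun (_ : T) => [pred a : 'F_p | a != 0]).
  rewrite /Tn => ->; rewrite prod_nat_const; congr (_ ^ _)%N.
  transitivity #|predC1 (0 : 'F_p)|; last by rewrite cardC1 card_F.
  by apply: eq_card => a; rewrite !inE.
have cover_Tn : (#|Tn| <= \sum_(code in good) #|solutions code|)%N.
  under [leqRHS]eq_bigr => code _ do rewrite -sum1_card.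
  rewrite (exchange_big_dep xpredT) //= -sum1_card big_mkcond; apply: leq_sum => t _.
  case: ifP => //; rewrite inE => /forallP /exists_code [code [t_code c0 cost]].
  rewrite sum1_card; apply/card_gt0P; exists code.
  rewrite unfold_in; apply/andP; split=> //; rewrite inE cost andbT; exact/forallP.
have le_sol code : code \in good -> (#|solutions code| * p.-1 ^ rho <= p.-1 ^ k)%N.
  rewrite inE => /andP[/forallP c0 _].
  have := @card_triangular_solutions 'F_p _ T f (fun j => code.1 j : nat)
     (fun j => signed_coef (code.2 j)) c0.
  by rewrite card_F.
rewrite -(@leq_pmul2l (p.-1 ^ k)) ?expn_gt0 ?p1 // -{1}card_Tn.
apply: leq_trans (leq_mul cover_Tn (leqnn _)) _.
rewrite big_distrl /=; apply: (@leq_trans (\sum_(code in good) p.-1 ^ k)).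
  by apply: leq_sum => code; apply: le_sol.
by rewrite sum_nat_const mulnC leq_mul2l card_good orbT.
Qed.
End IrredundantCover.

(** A subcover of least size is irredundant, and the relation for one member expresses its normal
    through the others, so the rank is less than the size. *)
Lemma minimal_subcover_rank (p : nat) (V : finZmodType) (X : finType)
    (f : X -> {ffun V -> ('F_p)^o}) (b : X -> 'F_p) (c : nat) :
    prime p -> (forall j, {morph f j : x y / x + y}) ->
    (forall x, exists j, f j x = b j) -> (20 <= c)%N ->
  exists M : {set X}, [/\ (0 < #|M|)%N,
    (\dim <<[seq f i | i in M]>>%VS < #|M|)%N &
    (p.-1 ^ \dim <<[seq f i | i in M]>>%VS <= (4 ^ c * sweep_length #|M|) ^ #|M|)%N].
Proof.
move=> p_pr f_add f_cover c_ge.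
pose P (M : {set X}) := [forall x, [exists j in M, f j x == b j]].
have PT : P setT.
  by apply/forallP => x; apply/existsP; have [j fj] := f_cover x; exists j; rewrite inE fj eqxx.
case: (arg_minnP (fun M : {set X} => #|M|) PT) => M PM minM.
have irred i : i \in M -> exists x, forall j, j \in M -> j != i -> f j x != b j.
  move=> iM; case: (boolP (P (M :\ i))) => [/minM|].
    by rewrite (cardsD1 i M) iM ltnn.
  rewrite negb_forall => /existsP[x]; rewrite negb_exists => /forallP xP.
  by exists x => j jM ji; have := xP j; rewrite !inE ji jM.
pose T : finType := {i | i \in M}.
have cov (x : V) : exists j : T, f (val j) x = b (val j).
  have /existsP[j /andP[jM /eqP fj]] := forallP PM x.
  by exists (exist _ j jM).
have irredT (i : T) : exists x, forall j : T, j != i -> f (val j) x != b (val j).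
  by have [x xP] := irred _ (valP i); exists x => j ji; apply: xP (valP j) _.
have card_T : #|T| = #|M| by rewrite card_sig; apply: eq_card => i; rewrite inE.
have span_T : <<[seq f (val i) | i in T]>>%VS = <<[seq f i | i in M]>>%VS.
  apply/eqP; rewrite eqEsubv; apply/andP; split; apply/span_subvP => w /imageP[i iM ->].
    by rewrite memv_span // image_f // (valP i).
  apply: memv_span; apply/imageP.
  by exists (exist _ i iM).
have addT (j : T) : {morph f (val j) : x y / x + y} by apply: f_add.
have [i0 _] := cov 0.
exists M; split.
- by rewrite -card_T; apply/card_gt0P; exists i0.
- have [J [J' [iJ iJ' rel]]] := @irredundant_cover_relation p V T (fun j => f (val j))
    (fun j => b (val j)) i0 p_pr addT cov (irredT i0).
  have fi : f (val i0) = \sum_(j in J) f (val j) - \sum_(j in J') f (val j).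
    by apply/ffunP => x; rewrite !ffunE !sum_ffunE rel.
  have sub : (<<[seq f i | i in M]>> <= <<[seq f (val i) | i in predC1 i0]>>)%VS.
    rewrite -span_T; apply/span_subvP => w /imageP[i _ ->].
    have in_span (j : T) : j != i0 -> f (val j) \in <<[seq f (val i) | i in predC1 i0]>>%VS.
      by move=> ji; rewrite memv_span // (image_f (fun j : T => f (val j))).
    have [->|] := eqVneq i i0; last exact: in_span.
    rewrite fi; apply: rpredB; apply: rpred_sum => j jJ; apply: in_span;
      [by apply: contraNneq iJ => <- | by apply: contraNneq iJ' => <-].
  apply: leq_ltn_trans (dimvS sub) _; apply: leq_ltn_trans (dim_span _) _.
  by rewrite size_map -cardE cardC1 card_T prednK // -card_T; apply/card_gt0P; exists i0.
rewrite -span_T -card_T.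
exact: (@irredundant_cover_rank p V T (fun j => f (val j)) (fun j => b (val j)) p_pr addT cov irredT _ c_ge).
Qed.

(** * From [F] to its prime field *)

Lemma prime_subfield_coordinates (F : finFieldType) : exists p e : nat,
  [/\ prime p, #|F| = (p ^ e)%N, p \in [pchar F] &
   exists2 iota : {rmorphism 'F_p -> F}, (forall a, iota a = (a : nat)%:R) &
   exists (co : 'I_e -> F -> 'F_p) (w : 'I_e -> F),
     (forall s, {morph co s : x y / x + y}) /\
     (forall z, z = \sum_s iota (co s z) * w s)].
Proof.
have [p p_pr pcharFp] := finPcharP F.
pose R := pPrimeCharType pcharFp.
exists p, (\dim {: R}); split=> //.
  by rewrite [LHS](card_pprimeChar pcharFp) pprimeChar_dimf.
pose iota : {rmorphism 'F_p -> F} := (GRing.in_alg R : {rmorphism 'F_p -> R}).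
have iotaE a : iota a = (a : nat)%:R by apply: mulr1.
exists iota => //.
exists (fun s (z : F) => coord (vbasis {: R}) s (z : R)), (fun s => (vbasis {: R})`_s).
split=> [s x y|z]; first exact: (linearD (coord (vbasis {: R}) s) (x : R) y).
rewrite {1}(coord_vbasis (memvf (z : R))).
by apply: eq_bigr => s _; rewrite iotaE.
Qed.

Section Functionals.
Variables (p e : nat) (F : finFieldType) (V : finType) (X C : finType).
Hypothesis p_pr : prime p.
Variables (iota : {rmorphism 'F_p -> F}) (co : 'I_e -> F -> 'F_p) (w : 'I_e -> F).
Hypothesis iotaE : forall a, iota a = (a : nat)%:R.
Hypothesis coE : forall z, z = \sum_s iota (co s z) * w s.
Variables (l : X -> V -> F) (inc : C -> {set X}).

Definition independent_on (D : {set X}) (g : X -> V -> F) : Prop :=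
  forall gam : X -> F, (forall x, \sum_(i in D) gam i * g i x = 0) ->
  forall i, i \in D -> gam i = 0.

Definition functional (v : {ffun 'I_e -> 'F_p}) (z : F) : 'F_p := \sum_s v s * co s z.

Lemma functionalB (v v' : {ffun 'I_e -> 'F_p}) z :
  functional [ffun s => v s - v' s] z = functional v z - functional v' z.
Proof. by rewrite /functional -sumrB; apply: eq_bigr => s _; rewrite ffunE mulrBl. Qed.

Lemma functionalZ (a : 'F_p) (v : {ffun 'I_e -> 'F_p}) z : functional [ffun s => a * v s] z = a * functional v z.
Proof. by rewrite /functional mulr_sumr; apply: eq_bigr => s _; rewrite ffunE mulrA. Qed.

Lemma additive_coordinates (h : F -> F) z : {morph h : x y / x + y} ->
  h z = \sum_s iota (co s z) * h (w s).
Proof.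
move=> hD; have h0 : h 0 = 0 by apply: (addIr (h 0)); rewrite -hD !add0r.
rewrite {1}[z]coE (big_morph h hD h0); apply: eq_bigr => s _.
rewrite iotaE !mulr_natl; elim: (nat_of_ord _) => [|n IH]; first by rewrite !mulr0n.
by rewrite !mulrS hD IH.
Qed.

(* The functionals [v] for which [v \o l x0] lies in the [F]-span of the other
   members of the family. *)
Definition bad_functionals (D : {set X}) (g : X -> V -> F) (x0 : X) :=
  [set v : {ffun 'I_e -> 'F_p} | [exists gam : {ffun X -> F}, [forall x,
     iota (functional v (l x0 x)) == \sum_(i in D :\ x0) gam i * g i x]]].

Lemma bad_functionalsP (D : {set X}) (g : X -> V -> F) (x0 : X) v :
  reflect (exists gam : X -> F, forall x,
     iota (functional v (l x0 x)) = \sum_(i in D :\ x0) gam i * g i x)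
  (v \in bad_functionals D g x0).
Proof.
rewrite inE; apply: (iffP existsP) => -[gam gamP].
  by exists gam => x; apply/eqP; move: x; apply/forallP.
exists [ffun i => gam i]; apply/forallP => x; rewrite gamP; apply/eqP.
by apply: eq_bigr => i _; rewrite ffunE.
Qed.

(** The bad functionals form an [F_p]-subspace. It is proper: if all coordinates were bad,
    [additive_coordinates] would put [g x0] in the span of the other members. The multiples of a
    functional outside it give [p] disjoint translates. *)
Lemma card_bad_functionals (D : {set X}) (g : X -> V -> F) (x0 : X) (h : F -> F) :
    x0 \in D -> {morph h : x y / x + y} -> (forall x, g x0 x = h (l x0 x)) ->
    independent_on D g ->
  (p * #|bad_functionals D g x0| <= p ^ e)%N.
Proof.
move=> x0D hD gx0 indep; set S := bad_functionals D g x0.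
have [v0 v0S] : exists v0, v0 \notin S.
  apply/existsP; apply: contraT; rewrite negb_exists => /forallP allS.
  pose unit_ s : {ffun 'I_e -> 'F_p} := [ffun r => (r == s)%:R].
  have unit_co s z : functional (unit_ s) z = co s z.
    rewrite /functional (bigD1 s) //= ffunE eqxx mul1r big1 ?addr0 // => r /negPf rs.
    by rewrite ffunE rs mul0r.
  have [gam gamP] : exists gam : 'I_e -> X -> F, forall s x,
      iota (co s (l x0 x)) = \sum_(i in D :\ x0) gam s i * g i x.
    apply: (@fin_all_exists _ _ (fun s gam => forall x,
       iota (co s (l x0 x)) = \sum_(i in D :\ x0) gam i * g i x)) => s.
    have /negPn /bad_functionalsP [gam gamP] := allS (unit_ s).
    by exists gam => x; rewrite -gamP unit_co.
  pose gam' i := if i == x0 then -1 else \sum_s gam s i * h (w s).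
  have := indep gam' _ x0 x0D; rewrite /gam' eqxx => /(_ _)/eqP; rewrite oppr_eq0 oner_eq0; apply.
  move=> x; rewrite (big_setD1 x0 x0D) /= eqxx mulN1r gx0 (additive_coordinates _ hD).
  rewrite (eq_bigr (fun s => \sum_(i in D :\ x0) gam s i * g i x * h (w s))); last first.
    by move=> s _; rewrite gamP mulr_suml.
  rewrite exchange_big /= addrC; apply/eqP; rewrite subr_eq0; apply/eqP.
  apply: eq_bigr => i; rewrite !inE => /andP[/negPf -> _]; rewrite mulr_suml.
  by apply: eq_bigr => s _; rewrite mulrAC.
have S_sub v v' : v \in S -> v' \in S -> [ffun s => v s - v' s] \in S.
  move=> /bad_functionalsP [gam gamP] /bad_functionalsP [gam' gamP'].
  apply/bad_functionalsP; exists (fun i => gam i - gam' i) => x.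
  rewrite functionalB rmorphB gamP gamP' -sumrB.
  by apply: eq_bigr => i _; rewrite mulrBl.
have S_scale a v : v \in S -> [ffun s => a * v s] \in S.
  move=> /bad_functionalsP [gam gamP]; apply/bad_functionalsP.
  exists (fun i => iota a * gam i) => x.
  rewrite functionalZ rmorphM gamP mulr_sumr.
  by apply: eq_bigr => i _; rewrite mulrA.
pose shift (av : 'F_p * {ffun 'I_e -> 'F_p}) := [ffun s => av.1 * v0 s + av.2 s] : {ffun 'I_e -> 'F_p}.
have shift_inj : {in setX setT S &, injective shift}.
  move=> [a v] [a' v']; rewrite !in_setX !in_setT /= => vS v'S eq_shift.
  have eq_s s : a * v0 s + v s = a' * v0 s + v' s.
    by have := congr1 (fun h : {ffun _} => h s) eq_shift; rewrite !ffunE.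
  have eq_a : a = a'.
    apply/eqP; apply: contraNT v0S => neq_a.
    have -> : v0 = [ffun s => (a - a')^-1 * [ffun s => v' s - v s] s]; last first.
      by apply: S_scale; apply: S_sub.
    apply/ffunP => s; rewrite !ffunE; apply: (mulfI (_ : a - a' != 0)); first by rewrite subr_eq0.
    rewrite mulrA mulfV ?subr_eq0 // mul1r.
    have := eq_s s; move: (v0 s) (v s) (v' s) => y y1 y2 /(congr1 (fun u => u - y1 - a' * y)).
    by rewrite addrK -mulrBl => ->; ring.
  by rewrite eq_a in eq_s *; congr pair; apply/ffunP => s; apply: (addrI (a' * v0 s)).
have := max_card [in shift @: setX setT S].
by rewrite (card_in_imset shift_inj) cardsX cardsT card_ffun card_Fp // card_ord.
Qed.

(** The maps [h] are exchanged for functionals one index at a time. Fewer than [p] bad sets, each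
    containing at most a fraction [1 / p] of all functionals, cannot exhaust them. *)
Lemma exists_independent_functionals (h : C -> X -> F -> F) :
    (forall c i, {morph h c i : x y / x + y}) ->
    (forall c, independent_on (inc c) (fun i x => h c i (l i x))) ->
    (forall i, (#|[set c | i \in inc c]| < p)%N) ->
  exists u : X -> {ffun 'I_e -> 'F_p},
    forall c, independent_on (inc c) (fun i x => iota (functional (u i) (l i x))).
Proof.
move=> hD h_indep few.
pose mixed (s : seq X) (u : X -> {ffun 'I_e -> 'F_p}) c i x :=
  if i \in s then iota (functional (u i) (l i x)) else h c i (l i x).
have step s : exists u, forall c, independent_on (inc c) (mixed s u c).
  elim: s => [|x0 s [u IH]]; first by exists (fun=> [ffun=> 0]).
  have [x0s|x0s] := boolP (x0 \in s).
    exists u => c gam gam0; apply: IH => x; rewrite -[RHS](gam0 x).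
    apply: eq_bigr => i _; rewrite /mixed in_cons.
    by case: (eqVneq i x0) => [->|]; rewrite ?x0s.
  pose S c := bad_functionals (inc c) (mixed s u c) x0.
  have [v vS] : exists v, forall c, x0 \in inc c -> v \notin S c.
    have : ~~ [forall v, [exists c, (x0 \in inc c) && (v \in S c)]].
      apply/negP => /forallP allS.
      have : (p ^ e <= \sum_(c | x0 \in inc c) #|S c|)%N.
        have -> : (p ^ e = #|{: {ffun 'I_e -> 'F_p}}|)%N by rewrite card_ffun card_Fp // card_ord.
        under eq_bigr => c _ do rewrite -sum1_card.
        rewrite (exchange_big_dep xpredT) //= -sum1_card; apply: leq_sum => v _.
        by rewrite sum1_card; apply/card_gt0P; have /existsP[c cP] := allS v; exists c.
      rewrite -(leq_pmul2l (prime_gt0 p_pr)) big_distrr /= leqNgt => /negP[].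
      apply: (@leq_ltn_trans (\sum_(c | x0 \in inc c) p ^ e)).
        apply: leq_sum => c x0c; apply: card_bad_functionals x0c (hD c x0) _ (IH c) => x.
        by rewrite /mixed (negPf x0s).
      rewrite sum_nat_const ltn_pmul2r ?expn_gt0 ?prime_gt0 //.
      by apply: leq_ltn_trans (few x0); rewrite leq_eqVlt; apply/orP; left; apply/eqP/eq_card => c; rewrite inE.
    rewrite negb_forall => /existsP[v]; rewrite negb_exists => /forallP vS.
    by exists v => c x0c; have := vS c; rewrite x0c.
  exists (fun i => if i == x0 then v else u i) => c gam gam0.
  have mixed_old i x : i != x0 ->
      mixed (x0 :: s) (fun i => if i == x0 then v else u i) c i x = mixed s u c i x.
    by move=> ix; rewrite /mixed in_cons (negPf ix).
  have [x0c|x0c] := boolP (x0 \in inc c); last first.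
    apply: IH => x; rewrite -[RHS](gam0 x); apply: eq_bigr => i ic.
    by rewrite mixed_old //; apply: contraNneq x0c => <-.
  have sum_new x : gam x0 * iota (functional v (l x0 x))
      + \sum_(i in inc c :\ x0) gam i * mixed s u c i x = 0.
    rewrite -[RHS](gam0 x) [in RHS](big_setD1 x0 x0c) /= {2}/mixed mem_head eqxx; congr (_ + _).
    by apply: eq_bigr => i; rewrite !inE => /andP[ix _]; rewrite mixed_old.
  have gam_x0 : gam x0 = 0.
    apply/eqP; apply: contraNT (vS c x0c) => nz; apply/bad_functionalsP.
    exists (fun i => - (gam x0)^-1 * gam i) => x; apply: (mulfI nz).
    move/eqP: (sum_new x); rewrite addr_eq0 => /eqP ->.
    rewrite mulr_sumr -sumrN; apply: eq_bigr => i _.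
    by rewrite mulrA mulNr mulrN mulrA mulfV // mul1r mulNr.
  apply: IH => x; rewrite (big_setD1 x0 x0c) /= gam_x0 mul0r add0r.
  by have := sum_new x; rewrite gam_x0 mul0r add0r.
have [u uP] := step (enum X); exists u => c gam gam0; apply: uP => x.
by rewrite -[RHS](gam0 x); apply: eq_bigr => i _; rewrite /mixed mem_enum.
Qed.

End Functionals.

Lemma dim_span_independent (K : fieldType) (W : vectType K) (X : finType)
    (f : X -> W) (D : {set X}) :
    (forall gam : X -> K, \sum_(i in D) gam i *: f i = 0 -> forall i, i \in D -> gam i = 0) ->
  (#|D| <= \dim <<[seq f i | i in D]>>%VS)%N.
Proof.
move=> indep.
have -> : [seq f i | i in D] = [tuple of map f (enum_tuple D)] by [].
suff /eqP -> : free [tuple of map f (enum_tuple D)] by rewrite size_tuple.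
apply/freeP => k sum0 i.
pose gam x := \sum_(r < #|D| | enum_val r == x) k r.
have gamE r : gam (enum_val r) = k r.
  by rewrite /gam (big_pred1 r) // => s; rewrite /= (inj_eq enum_val_inj).
rewrite -gamE; apply: indep (enum_valP i).
rewrite big_enum_val -[RHS]sum0; apply: eq_bigr => r _.
rewrite gamE; congr (_ *: _).
by rewrite /= (nth_map (enum_val r)) -?cardE // -enum_val_nth.
Qed.

Lemma Frobenius_additive (p d : nat) (F : fieldType) : p \in [pchar F] ->
  {morph (fun z : F => z ^+ (p ^ d)) : x y / x + y}.
Proof.
move=> pcharF x y; apply: exprDn_pchar; apply/pnatP => [|r r_pr].
  by rewrite expn_gt0 prime_gt0 ?(pcharf_prime pcharF).
by rewrite Euclid_dvdX // => /andP[]; rewrite dvdn_prime2 ?(pcharf_prime pcharF) // => /eqP ->.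
Qed.

(** * The hyperplanes of the multipartite game *)

Section Multipartite.
Variables (m n : nat) (F : finFieldType).
Let X : finType := ('I_m * 'I_n)%type.
Variables (a : X -> X -> F).

(** The vertex [w] is right exactly when this equals [b w]. Colourings are matrices so that they
    form a finite additive group. *)
Definition guess_form (w : X) (x : 'M[F]_(m, n)) : F :=
  x w.1 w.2 - \sum_(w' | Kmpart_adj m n w w') a w w' * x w'.1 w'.2.

Lemma guess_form_add w : {morph guess_form w : x y / x + y}.
Proof.
move=> x y; rewrite /guess_form mxE (eq_bigr (fun w' => a w w' * x w'.1 w'.2 + a w w' * y w'.1 w'.2)).
  by rewrite big_split /=; ring.
by move=> w' _; rewrite mxE mulrDr.
Qed.

Definition parts_union (P : pred 'I_m) : {set X} := [set w | P w.1].

(* Distinct parts get distinct Frobenius exponents.  On the line spanned by one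
   basis vector the sum is a polynomial of degree below [#|F|], hence zero, and its
   coefficient at the exponent of [w0] only sees the part of [w0]. *)
Lemma Frobenius_twists_independent (p e : nat) (P : pred 'I_m) (dig : 'I_m -> nat) :
    (1 < p)%N -> #|F| = (p ^ e)%N -> (forall i, P i -> (dig i < e)%N) -> {in P &, injective dig} ->
  independent_on (parts_union P) (fun w x => guess_form w x ^+ (p ^ dig w.1)).
Proof.
move=> p1 cardF dig_lt dig_inj gam gam0 w0 w0P.
pose lam w : F := guess_form w (\matrix_(i, j) ((i, j) == w0)%:R).
have form_line w z : guess_form w (\matrix_(i, j) if (i, j) == w0 then z else 0) = lam w * z.
  rewrite /lam /guess_form !mxE -surjective_pairing mulrBl mulr_suml; congr (_ - _).
    by case: eqP => _; rewrite ?mul1r ?mul0r.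
  by apply: eq_bigr => i _; rewrite !mxE -surjective_pairing; case: eqP => _; rewrite ?mulr1 ?mulr0 ?mul0r.
pose Q : {poly F} := \sum_(w in parts_union P) (gam w * lam w ^+ (p ^ dig w.1)) *: 'X^(p ^ dig w.1).
have Q0 z : Q.[z] = 0.
  rewrite -[RHS](gam0 (\matrix_(i, j) if (i, j) == w0 then z else 0)) horner_sum.
  by apply: eq_bigr => w _; rewrite hornerZ hornerXn form_line exprMn mulrA.
have sizeQ : (size Q <= #|F|)%N.
  apply: leq_trans (size_sum _ _ _) _; apply/bigmax_leqP => w; rewrite inE => wP.
  apply: leq_trans (size_scale_leq _ _) _; rewrite size_polyXn cardF.
  by rewrite ltn_exp2l // dig_lt.
have Qz : Q = 0.
  apply: (@roots_geq_poly_eq0 _ _ (enum F)); rewrite ?enum_uniq -?cardE //.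
  by apply/allP => z _; apply/rootP.
have := congr1 (fun q : {poly F} => q`_(p ^ dig w0.1)) Qz.
rewrite coef0 coef_sum (bigD1 w0) //= coefZ coefXn eqxx mulr1.
have lam_part w : w.1 = w0.1 -> lam w = (w == w0)%:R.
  move=> w1; rewrite /lam /guess_form mxE -surjective_pairing big1 ?subr0 // => i.
  rewrite /Kmpart_adj mxE -surjective_pairing => neq; case: eqP => [iw0|_]; last by rewrite mulr0.
  by move: neq; rewrite iw0 w1 eqxx.
rewrite lam_part // eqxx expr1n mulr1 big1 ?addr0 // => w /andP[wP ww0].
rewrite coefZ coefXn eqn_exp2l //; case: eqP => [eq_dig|_]; last by rewrite mulr0.
rewrite !inE in wP w0P.
rewrite lam_part; last by apply: dig_inj.
by rewrite (negPf ww0) expr0n expn_eq0 -leqn0 leqNgt (ltnW p1) /= mulr0 mul0r.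
Qed.

(** Composing with functionals that keep every chunk [F_p]-independent turns the winning property
    into a cover over [F_p]. Here [M] is a minimal subcover and [r] its rank, which bounds the
    members of [M] in any chunk. *)
Lemma winning_chunk_bound (C : finType) (P : C -> pred 'I_m) (dig : C -> 'I_m -> nat)
    (p e K : nat) (b : X -> F) :
    prime p -> #|F| = (p ^ e)%N -> (20 <= K)%N ->
    (forall c i, P c i -> (dig c i < e)%N) -> (forall c, {in P c &, injective (dig c)}) ->
    (forall i, (#|[set c | P c i]| < p)%N) ->
    winning_linear (Kmpart_adj m n) a b ->
  exists (M : {set X}) (r : nat), [/\ (r < #|M|)%N,
    (p.-1 ^ r <= (4 ^ K * sweep_length #|M|) ^ #|M|)%N &
    forall c, (#|M :&: parts_union (P c)| <= r)%N].
Proof.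
move=> p_pr cardF K_ge dig_lt dig_inj few win.
have [p' [e' [p'_pr cardF' pcharF [iota iotaE [co [w [coD coE]]]]]]] := prime_subfield_coordinates F.
have pp' : p' = p.
  apply/eqP; rewrite -dvdn_prime2 //.
  have e'0 : (0 < e')%N.
    by move: (finNzRing_gt1 F); rewrite cardF'; case: e' {cardF' co w coD coE}.
  have : (p' %| p ^ e)%N by rewrite -cardF cardF' dvdn_exp.
  by rewrite Euclid_dvdX // => /andP[].
have ee' : e' = e.
  by apply/eqP; rewrite -(eqn_exp2l _ _ (prime_gt1 p_pr)) -cardF cardF' pp'.
subst p' e'.
have few' (i : X) : (#|[set c | i \in parts_union (P c)]| < p)%N.
  by apply: leq_ltn_trans (few i.1); apply/subset_leq_card/subsetP => c; rewrite !inE.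
have [u u_indep] := exists_independent_functionals p_pr iotaE coE
  (l := guess_form) (inc := fun c => parts_union (P c)) (h := fun c i z => z ^+ (p ^ dig c i.1))
  (fun c i => Frobenius_additive _ pcharF)
  (fun c => Frobenius_twists_independent (prime_gt1 p_pr) cardF (@dig_lt c) (@dig_inj c)) few'.
have functionalD v : {morph functional co v : x y / x + y}.
  by move=> x y; rewrite /functional -big_split; apply: eq_bigr => s _; rewrite coD mulrDr.
pose f i : {ffun 'M[F]_(m, n) -> ('F_p)^o} := [ffun x => functional co (u i) (guess_form i x)].
have f_add i : {morph f i : x y / x + y}.
  by move=> x y; rewrite !ffunE guess_form_add functionalD.
have f_cover x : exists i, f i x = functional co (u i) (b i).
  have [i wini] := win (fun i => x i.1 i.2); exists i; rewrite ffunE; congr functional.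
  by rewrite /guess_form -wini /linear_guess addrC addKr.
have [M [_ M_dep M_rank]] := minimal_subcover_rank p_pr f_add f_cover K_ge.
exists M, (\dim <<[seq f i | i in M]>>%VS); split=> // c.
apply: (@leq_trans (\dim <<[seq f i | i in (M :&: parts_union (P c))%SET]>>%VS)); last first.
  apply/dimvS/span_subvP => g /imageP[i]; rewrite inE => /andP[iM _] ->.
  by rewrite memv_span // image_f.
apply: dim_span_independent => gam gam0 i; rewrite inE => /andP[iM ic].
pose gam' i := if i \in M then iota (gam i) else 0.
suff : gam' i = 0 by rewrite /gam' iM => /eqP; rewrite fmorph_eq0 => /eqP.
apply: u_indep ic => x.
have := congr1 (fun g : {ffun 'M[F]_(m, n) -> ('F_p)^o} => iota (g x)) gam0.
rewrite ffunE rmorph0 sum_ffunE rmorph_sum => sum_f; rewrite -[RHS]sum_f.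
rewrite [RHS](eq_bigl (fun i => (i \in parts_union (P c)) && (i \in M))); last first.
  by move=> j; rewrite in_setI andbC.
rewrite big_mkcondr; apply: eq_bigr => j _; rewrite /gam'.
case: ifP => _; last by rewrite mul0r.
by rewrite !ffunE -rmorphM.
Qed.

End Multipartite.

(** * Cyclic distribution of the parts into chunks *)

Section Chunks.
Variables (m e q : nat).
Hypotheses (e_gt0 : (0 < e)%N) (le_em : (e <= m)%N).

(* Part [i] occupies the slots [h * m + i] for [h < q], and chunk [c] consists of the
   slots from [c * e] to [c * e + e - 1]; [chunk_digit c i] is the offset in chunk [c]
   of the only slot that could belong to part [i]. *)
Definition chunk_digit (c i : nat) : nat := ((i + m.-1 * (c * e)) %% m)%N.
Definition in_chunk (c i : nat) : bool :=
  (chunk_digit c i < e)%N && (c * e + chunk_digit c i < q * m)%N.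

Lemma chunk_digit_inj c i j : (i < m)%N -> (j < m)%N ->
  chunk_digit c i = chunk_digit c j -> i = j.
Proof.
move=> im jm /eqP; rewrite /chunk_digit eqn_modDr => /eqP.
by rewrite !modn_small.
Qed.

(** [m.-1] stands for [-1] modulo [m], which expresses [i - c * e] without subtraction. *)
Lemma chunk_digit_slot c i : (c * e + chunk_digit c i = i %[mod m])%N.
Proof.
have m0 : (0 < m)%N by apply: leq_trans le_em.
rewrite /chunk_digit modnDmr addnCA -{1}[(c * e)%N]mul1n -mulnDl add1n prednK //.
by rewrite addnC mulnC modnMDl.
Qed.

(** Slots of one part are at least [m >= e] apart, so its [q] slots lie in [q] distinct chunks. *)
Lemma card_chunks_of_part (i : 'I_m) :
  #|[set c : 'I_((q * m) %/ e).+1 | in_chunk c i]| = q.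
Proof.
have m0 : (0 < m)%N by apply: leq_trans le_em.
have slot_lt (h : 'I_q) : (h * m + i < q * m)%N.
  apply: (@leq_trans (h.+1 * m)); last by rewrite leq_mul2r ltn_ord orbT.
  by rewrite mulSn addnC ltn_add2r.
have chunk_lt (h : 'I_q) : ((h * m + i) %/ e < ((q * m) %/ e).+1)%N.
  by rewrite ltnS leq_div2r // ltnW.
pose chunk h := Ordinal (chunk_lt h).
have chunk_digit_h h : (chunk_digit (chunk h) i = (h * m + i) %% e)%N.
  have := chunk_digit_slot (chunk h) i.
  have : (chunk h * e + (h * m + i) %% e = i %[mod m])%N by rewrite /= -divn_eq modnMDl.
  move=> <- /eqP; rewrite eqn_modDl => /eqP.
  have lt_r : ((h * m + i) %% e < m)%N by apply: leq_trans le_em; rewrite ltn_mod.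
  by rewrite (modn_small lt_r) modn_small // /chunk_digit ltn_mod.
have -> : [set c : 'I_((q * m) %/ e).+1 | in_chunk c i] = [set chunk h | h : 'I_q].
  apply/setP => c; rewrite inE; apply/idP/imsetP => [/andP[lt_e lt_slot]|[h _ ->]]; last first.
    by rewrite /in_chunk chunk_digit_h ltn_mod e_gt0 /= -divn_eq slot_lt.
  have h_lt : ((c * e + chunk_digit c i) %/ m < q)%N by rewrite ltn_divLR.
  exists (Ordinal h_lt) => //; apply: val_inj => /=.
  have -> : ((c * e + chunk_digit c i) %/ m * m + i = c * e + chunk_digit c i)%N.
    by rewrite {2}(divn_eq (c * e + chunk_digit c i) m) chunk_digit_slot modn_small.
  by rewrite divnMDl // (divn_small lt_e) addn0.
rewrite card_imset ?card_ord // => h h' /(congr1 val) /= eq_c.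
have := chunk_digit_h h; have := chunk_digit_h h'.
have -> : chunk_digit (chunk h') i = chunk_digit (chunk h) i by rewrite /chunk_digit /= eq_c.
move=> -> eq_mod.
have : (h * m + i = h' * m + i)%N by rewrite (divn_eq (h * m + i) e) eq_c -eq_mod -divn_eq.
by move/addIn/eqP; rewrite eqn_pmul2r // => /eqP/val_inj.
Qed.

End Chunks.

(** * The numerical comparison and the final bound *)

(** The two estimates give [(p - 1) ^ b <= (K * b) ^ d] with [d * e <= b * m + e], hence
    [p ^ (e * b) <= (4 * K ^ 2 * b) ^ (b * m)]. One factor [2] pays for [p <= 2 * (p - 1)]; the
    other, with the second [K], absorbs the rounding loss [(K * b) ^ e], using [b <= 2 ^ b]. *)
Lemma rank_bound_contradiction (p e m b K k r : nat) :
    (1 < p)%N -> (0 < e <= m)%N -> (0 < b)%N -> (0 < K)%N -> (0 < k)%N ->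
    ((8 * K ^ 2 * b) ^ m <= p ^ e)%N ->
    (b * k <= ((b * m) %/ e).+1 * r)%N -> (p.-1 ^ r <= (K * b) ^ k)%N -> False.
Proof.
move=> p1 /andP[e0 le_em] b0 K0 k0 big le_k le_rank; set d := ((b * m) %/ e).+1 in le_k.
have r0 : (0 < r)%N.
  by rewrite lt0n; apply: contraTneq le_k => ->; rewrite muln0 -ltnNge muln_gt0 b0 k0.
have Kb0 : (0 < K * b)%N by rewrite muln_gt0 K0.
have le_pb : (p.-1 ^ b <= (K * b) ^ d)%N.
  rewrite -(leq_exp2r _ _ r0) -!expnM [(b * r)%N]mulnC expnM.
  apply: (@leq_trans (((K * b) ^ k) ^ b)); first by rewrite leq_exp2r.
  by rewrite -!expnM leq_pexp2l // [(k * b)%N]mulnC.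
have le_de : (d * e <= b * m + e)%N by rewrite /d mulSn addnC leq_add2r leq_divM.
have {le_pb} : (p ^ (e * b) <= 4 ^ (b * m) * (K * K * b) ^ (b * m))%N.
  have le_p : (p <= 2 * p.-1)%N by clear -p1; lia.
  apply: (@leq_trans (2 ^ (e * b) * (p.-1 ^ b) ^ e)).
    by rewrite -expnM [(b * e)%N]mulnC -expnMn leq_exp2r // muln_gt0 e0.
  apply: (@leq_trans (2 ^ (e * b) * (K * b) ^ (b * m + e))).
    rewrite leq_mul2l; apply/orP; right.
    by apply: leq_trans (_ : (K * b) ^ (d * e) <= _)%N; [rewrite expnM leq_exp2r | rewrite leq_pexp2l].
  rewrite expnD (expnMn K b e).
  have le_eb : (e * b <= b * m)%N by rewrite mulnC leq_mul2l le_em orbT.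
  have h1 : (2 ^ (e * b) <= 2 ^ (b * m))%N by rewrite leq_exp2l.
  have h2 : (b ^ e <= 2 ^ (b * m))%N.
    apply: leq_trans h1; rewrite mulnC expnM leq_exp2r //; exact/ltnW/ltn_expl.
  have h3 : (K ^ e <= K ^ (b * m))%N.
    by rewrite leq_pexp2l // (leq_trans _ le_eb) // leq_pmulr.
  apply: leq_trans (leq_mul h1 (leq_mul (leqnn ((K * b) ^ (b * m))) (leq_mul h3 h2))) _.
  have -> : (4 ^ (b * m) = 2 ^ (b * m) * 2 ^ (b * m))%N by rewrite -expnMn.
  rewrite !expnMn; move: (2 ^ _)%N (K ^ _)%N (b ^ _)%N => x y z.
  by rewrite leq_eqVlt; apply/orP; left; apply/eqP; ring.
rewrite leqNgt => /negP[]; apply: (@leq_trans (((8 * K ^ 2 * b) ^ m) ^ b)); last first.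
  by rewrite expnM leq_exp2r.
rewrite -expnM [(m * b)%N]mulnC -expnMn ltn_exp2r; last by rewrite muln_gt0 b0 (leq_trans e0).
by rewrite -mulnn !mulnA !ltn_pmul2r.
Qed.

Lemma leq_sweep_length i j : (i <= j)%N -> (sweep_length i <= sweep_length j)%N.
Proof. by move=> le_ij; rewrite /sweep_length leq_add2r leq_mul2l /= leq_trunc_log. Qed.

Lemma no_winning_linear_large_field : exists D : nat,
  forall (n m : nat) (F : finFieldType), (0 < m)%N ->
    ((D * sweep_length (n * m)) ^ m <= #|F|)%N ->
  ~ has_winning_linear_strategy F (Kmpart_adj m n).
Proof.
have [K K_ge] : exists K, (20 <= K)%N by exists 20%N.
exists (8 * (4 ^ K) ^ 2)%N => n m F m0 big [a [b win]].
have [p [e [p_pr cardF _ _]]] := prime_subfield_coordinates F.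
have e0 : (0 < e)%N by move: (finNzRing_gt1 F); rewrite cardF; case: e {cardF}.
have p1 := prime_gt1 p_pr.
(* If [e >= m], one chunk holds all parts, so the subcover would be independent, against
   [r < #|M|]. *)
have [le_me|lt_em] := leqP m e.
  have few (i : 'I_m) : (#|[set c : unit | predT i]| < p)%N.
    by apply: leq_ltn_trans (max_card _) _; rewrite card_unit.
  have [M [r [lt_rM _ le_Mr]]] := @winning_chunk_bound m n F a unit (fun=> predT)
    (fun _ i => i) p e K b p_pr cardF K_ge (fun _ i _ => leq_trans (ltn_ord i) le_me)
    (fun _ => in2W (@val_inj _ _ _)) few win.
  have := le_Mr tt; rewrite leqNgt => /negP[]; apply: leq_trans lt_rM _.
  by apply/subset_leq_card/subsetP => w wM; rewrite !inE wM.
set L := sweep_length (n * m) in big.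
have L0 : (0 < L)%N by rewrite /L /sweep_length addnS.
set D := (8 * (4 ^ K) ^ 2)%N in big.
have D1 : (1 < D)%N.
  by apply: (@leq_trans 8) => //; apply: leq_pmulr; rewrite !expn_gt0.
(* As [e < m], the bound on [m]-th powers implies the one on [e]-th powers. It yields [L < p],
   needed to place each part in [L] chunks. *)
have le_DLp : (D * L <= p)%N.
  rewrite -(leq_exp2r _ _ e0) -cardF; apply: leq_trans big.
  by apply: leq_pexp2l (ltnW lt_em); rewrite muln_gt0 L0 (ltnW D1).
have lt_Lp : (L < p)%N by apply: leq_trans le_DLp; rewrite ltn_Pmull.
have e_le_m := ltnW lt_em.
have [M [r [lt_rM rank le_Mr]]] := @winning_chunk_bound m n F a 'I_((L * m) %/ e).+1
   (fun c i => in_chunk m e L c i) (fun c i => chunk_digit m e c i) p e K b p_pr cardF K_ge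
   (fun c i => fun ci => proj1 (andP ci))
   (fun c => in2W (fun i j => fun h => val_inj (chunk_digit_inj (ltn_ord i) (ltn_ord j) h)))
   (fun i => eq_ind_r (fun k => k < p)%N lt_Lp (card_chunks_of_part L e0 e_le_m i)) win.
have M0 : (0 < #|M|)%N by apply: leq_trans lt_rM.
have le_MN : (#|M| <= n * m)%N by rewrite (leq_trans (max_card _)) // card_prod !card_ord mulnC.
apply: (@rank_bound_contradiction p e m L (4 ^ K) #|M| r) => //.
- by rewrite e0.
- by rewrite expn_gt0.
- by rewrite -cardF.
- have -> : (L * #|M| = \sum_(c < ((L * m) %/ e).+1) #|M :&: parts_union n (in_chunk m e L c)|)%N.
    under eq_bigr => c _ do (rewrite -sum1_card; under eq_bigl => w do rewrite in_setI; rewrite big_mkcondr).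
    rewrite exchange_big /= mulnC -sum_nat_const; apply: eq_bigr => w _.
    rewrite -[LHS](card_chunks_of_part L e0 e_le_m w.1) -sum1_card big_mkcond /=.
    by apply: eq_bigr => c _; rewrite !inE.
  apply: (@leq_trans (\sum_(c < ((L * m) %/ e).+1) r)); first by apply: leq_sum => c _; apply: le_Mr.
  by rewrite sum_nat_const card_ord.
apply: leq_trans rank _; rewrite leq_exp2r // leq_mul2l; apply/orP; right.
exact: leq_sweep_length.
Qed.

(** With one part every guess is constant. The case is separate because [n * m] may be [1], where
    the logarithm vanishes. *)
Lemma no_winning_linear_one_part (n : nat) (F : finFieldType) :
  ~ has_winning_linear_strategy F (Kmpart_adj 1 n).
Proof.
move=> [a [b win]]; have [w] := win (fun w => b w + 1).
rewrite /linear_guess big_pred0 => [/eqP|w']; last by rewrite /Kmpart_adj !ord1.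
by rewrite add0r eq_sym -subr_eq0 addrAC subrr add0r oner_eq0.
Qed.

(* From binary to natural logarithms *)
Close Scope ring_scope.
From mathcomp Require Import all_boot all_algebra.
From Stdlib Require Import Reals.
From Stdlib Require Lra.

Lemma INR_expn (x n : nat) : INR (expn x n) = (INR x ^ n)%R.
Proof. by elim: n => [|n IH] //=; rewrite expnS -multE mult_INR IH. Qed.

Lemma INR_leq (i j : nat) : leq i j -> (INR i <= INR j)%R.
Proof. by move/leP; apply: le_INR. Qed.

Lemma ln_le (x y : R) : (0 < x)%R -> (x <= y)%R -> (ln x <= ln y)%R.
Proof. by move=> x0 [lt|->]; [left; apply: ln_increasing | right]. Qed.

Lemma half_le_ln (N : nat) : leq 2 N -> (/ 2 <= ln (INR N))%R.
Proof.
move=> N2; have ln2 := ln_lt_2; have leN := INR_leq N2; rewrite /= in leN.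
apply: (Rle_trans _ (ln 2)); first exact: Rlt_le.
by apply: ln_le; Lra.lra.
Qed.

Lemma trunc_log2_le_ln (N : nat) : leq 1 N -> (INR (trunc_log 2 N) <= 2 * ln (INR N))%R.
Proof.
move=> N1; have ln2 := ln_lt_2.
have /andP[/INR_leq le_N _] := trunc_log_bounds (isT : leq 2 2) N1.
rewrite INR_expn in le_N.
have ge0 := pos_INR (trunc_log 2 N).
have pos : (0 < INR 2 ^ trunc_log 2 N)%R by apply: pow_lt; rewrite /=; Lra.lra.
have le_ln : (ln (INR 2 ^ trunc_log 2 N) <= ln (INR N))%R.
  exact: ln_le.
rewrite ln_pow in le_ln; last by rewrite /=; Lra.lra.
rewrite (_ : INR 2 = 2%R) in le_ln; last by rewrite /=; Lra.lra.
by Lra.nra.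
Qed.

(** [46 = 8 + 38], where [19 <= 38 * ln N] because [ln N >= 1 / 2]. *)
Lemma sweep_length_le_ln (N : nat) : leq 2 N -> (INR (sweep_length N) <= 46 * ln (INR N))%R.
Proof.
move=> N2; have half := half_le_ln N2; have lg := trunc_log2_le_ln (ltnW N2).
rewrite /sweep_length -plusE -multE plus_INR mult_INR.
rewrite (_ : INR 4 = 4%R); last by rewrite /=; Lra.lra.
rewrite (_ : INR 19 = 19%R); last by rewrite /=; Lra.lra.
by Lra.lra.
Qed.

Theorem theorem3 :
  exists c : R, (0 < c)%R /\
    forall n m : nat, (0 < n)%N -> (0 < m)%N ->
    forall F : finFieldType,
      (INR #|F| >= (c * ln (INR (n * m))) ^ m)%R ->
      ~ has_winning_linear_strategy F (Kmpart_adj m n).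
Proof.
have [D noD] := no_winning_linear_large_field; have D0 := pos_INR D.
(* The summand [1] keeps the constant positive, [INR D] being known only to be nonnegative. *)
exists (46 * INR D + 1)%R; split; first by Lra.lra.
move=> n m n0 m0 F big.
case: m m0 big => [|[|m]] // _ big; first exact: no_winning_linear_one_part.
apply: noD => //; apply/leP/INR_le; rewrite INR_expn -multE mult_INR multE.
apply: Rle_trans (Rge_le _ _ big).
have N2 : leq 2 (muln n m.+2) by rewrite mulnC; apply: leq_trans (leq_pmulr _ n0).
have le_ln := sweep_length_le_ln N2; have half := half_le_ln N2.
apply: pow_incr; split; first by apply: Rmult_le_pos => //; apply: pos_INR.
have := Rmult_le_compat_l _ _ _ D0 le_ln.
by Lra.nra.
Qed.
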